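(* Let $\phi$ be a proper parametrization of degree $d$ of a rational plane curve $C$ such that $\mu<d-\mu$ and such that $C$ has $(0:0:1)$ as a very singular point. Write $d=k\mu+r$ as described in the context, and let $F_{\mu,1}(\underline T,\underline X)$ and $F_{(k-j)\mu+r,j}(\underline T,\underline X)$, $1\le j\le k-1$, be the polynomials constructed in the context (for any admissible choices in the construction). Then: \begin{enumerate} \item For each $j=1,\ldots,k-1$, $F_{(k-j)\mu+r,j}(\underline T,\underline X)\in\mathcal K$ and it is not a multiple of $F_{\mu,1}(\underline T,\underline X)$. In particular, it is not identically zero. \item Up to a nonzero constant in $\mathbb K$, $\mathrm{Res}_{\underline T}\left(F_{\mu,1}(\underline T,\underline X),F_{(k-j)\mu+r,j}(\underline T,\underline X)\right)=\mathcal E_d(\underline X)$ for $j=1,2,\ldots,k-1$. \item If $G_{i,j}(\underline T,\underline X)\in\mathcal K_{i,j}$ with $i+\mu j<d$, then $G_{i,j}(\underline T,\underline X)$ is a multiple of $F_{\mu,1}(\underline T,\underline X)$. \item The set of $k+1$ elements $$\{\mathcal E_d(\underline X),\,F_{\mu,1}(\underline T,\underline X),\,F_{\mu+r,k-1}(\underline T,\underline X),\,F_{2\mu+r,k-2}(\underline T,\underline X),\ldots,F_{d-\mu,1}(\underline T,\underline X)\}$$ is part of a minimal system of generators of $\mathcal K$. \end{enumerate}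
   Context: Let $\mathbb K$ be an algebraically closed field, $\underline T=(T_0,T_1)$, $\underline X=(X_0,X_1,X_2)$, and let $u_0,u_1,u_2\in\mathbb K[\underline T]$ be homogeneous of the same degree $d\ge1$ without common factors; $\underline u=(u_0,u_1,u_2)$, $I=\langle u_0,u_1,u_2\rangle\subset\mathbb K[\underline T]$. $\mathrm{Rees}(I)=\bigoplus_{n\ge0}I^nZ^n$ ($Z$ a new variable) and $\mathcal K$ is the kernel of the $\mathbb K[\underline T]$-algebra epimorphism $\mathbb K[\underline T][\underline X]\to\mathrm{Rees}(I)$, $X_i\mapsto u_i(\underline T)Z$. $\mathcal K$ is a bihomogeneous ideal; $\mathcal K_{i,j}$ is its component of bidegree $(i,j)$ ($i$ in $\underline T$, $j$ in $\underline X$), i.e. the bihomogeneous $P$ of bidegree $(i,j)$ with $P(\underline T,\underline u(\underline T))=0$. A double subscript $i,j$ on a polynomial in $\underline T,\underline X$ denotes its bidegree. $\mathcal K_{*,1}\cong\mathrm{Syz}(I)$ is a free $\mathbb K[\underline T]$-module of rank 2; fix a basis $P_{\mu,1},Q_{d-\mu,1}$ of bidegrees $(\mu,1),(d-\mu,1)$ with $0\le\mu\le d/2$ ($\mu$ is determined by $I$). The map $\phi:\mathbb P^1\to\mathbb P^2$, $(t_0:t_1)\mapsto(u_0:u_1:u_2)(t_0,t_1)$, is proper, i.e. birational onto its image $C$. $\mathcal E_d(\underline X)$ is the irreducible homogeneous polynomial of degree $d$ defining $C$ (it generates $\mathcal K\cap\mathbb K[\underline X]$; unique up to a nonzero constant).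 $\mathrm{Res}_{\underline T}$ is the homogeneous Sylvester resultant with respect to $\underline T$. A point $\mathbf p\in C$ is very singular if $\mathrm{mult}_{\mathbf p}(C)>\mu$. If $(0:0:1)$ is very singular, then $P_{\mu,1}=p^1_\mu(\underline T)X_0-p^0_\mu(\underline T)X_1$ with $p^0_\mu,p^1_\mu\in\mathbb K[\underline T]$ homogeneous of degree $\mu$. Operator $\mathcal D_T$: if $G_{i,j}\in\mathbb K[\underline T,\underline X]$ has bidegree $(i,j)$ with $i\ge2\mu-1$, write $G_{i,j}=p^0_\mu(\underline T)G^0_{i-\mu,j}(\underline T,\underline X)+p^1_\mu(\underline T)G^1_{i-\mu,j}(\underline T,\underline X)$ (choose one such decomposition) and set $\mathcal D_T(G_{i,j})=X_0G^0_{i-\mu,j}+X_1G^1_{i-\mu,j}$, of bidegree $(i-\mu,j+1)$. Write $d=k\mu+r$ with $k\in\mathbb N$ and $-1\le r<\mu-1$, i.e. $k$ and $r$ are the quotient and remainder of the division of $d$ by $\mu$, except in the case when $d+1$ is a multiple of $\mu$. Set $F_{\mu,1}:=P_{\mu,1}$, $F_{(k-1)\mu+r,1}:=Q_{d-\mu,1}$, and recursively, for $j=2,\ldots,k-1$, $F_{(k-j)\mu+r,j}:=\mathcal D_T\big(F_{(k-j+1)\mu+r,j-1}\big)$ (each step involving a choice).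
   Formalization: In item 4, when μ=1 one has F_{μ+r,k-1}=F_{0,d}, a nonzero constant times E_d, so the listed k+1 elements repeat E_d and the claim fails (e.g. nodal cubic); for μ=1 the formal statement takes the list without E_d. *)

(* Defs.v *)
From HB Require Import structures.
From mathcomp Require Import all_boot all_order all_algebra.
From mathcomp Require Import mpoly.

Set Implicit Arguments.
Unset Strict Implicit.
Unset Printing Implicit Defensive.

Import GRing.Theory.
Local Open Scope ring_scope.

(* K[T][X] with T = (T_0, T_1) and X = (X_0, X_1, X_2); K[T] acts by *: *)
Notation ringT K := {mpoly K[2]}.
Notation ringX K := {mpoly K[3]}.
Notation ringTX K := {mpoly {mpoly K[2]}[3]}.

Section Divisibility.
Variable A : comUnitRingType.
Implicit Types (a b : A) (S : seq A) (I : A -> Prop).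

Definition multiple_of a b := exists c, a = c * b.

Definition irreducible_elt a :=
  [/\ a != 0, a \isn't a GRing.unit
    & forall b c, a = b * c -> b \is a GRing.unit \/ c \is a GRing.unit].

Definition ideal_gen S a :=
  exists c : nat -> A, a = \sum_(i < size S) c i * S`_i.

Definition generates I S := forall a, I a <-> ideal_gen S a.

Definition min_generates I S :=
  generates I S /\ forall S', subseq S' S -> generates I S' -> S' = S.

End Divisibility.

Section ProjectivePoints.
Variable K : closedFieldType.

(* Points of P^(n-1) are nonzero vectors, compared by [proj_eq]. *)
Definition nonzero_vec n (x : 'I_n -> K) := exists i, x i != 0.

Definition proj_eq n (x y : 'I_n -> K) :=
  exists c, c != 0 /\ forall i, x i = c * y i.

Definition ev m n (f : 'I_n -> {mpoly K[m]}) (t : 'I_m -> K) : 'I_n -> K :=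
  fun i => (f i).@[t].

End ProjectivePoints.

Section Parametrization.
Variables (K : closedFieldType) (u : 'I_3 -> ringT K).

Definition parametrization d :=
  [/\ (0 < d)%N, forall i, u i \is d.-homog
    & forall g, (forall i, multiple_of (u i) g) -> g \is a GRing.unit].

Definition curve (x : 'I_3 -> K) :=
  nonzero_vec x /\ exists t, nonzero_vec t /\ proj_eq x (ev u t).

(* phi is birational onto C: some rational map psi : C --> P^1, given by two
   forms of the same degree not both vanishing on C, is inverse to phi. *)
Definition proper_param :=
  exists (e : nat) (psi : 'I_2 -> ringX K),
  [/\ forall i, psi i \is e.-homog,
      exists x, curve x /\ nonzero_vec (ev psi x),
      forall t, nonzero_vec t -> nonzero_vec (ev psi (ev u t)) ->
        proj_eq (ev psi (ev u t)) t
    & forall x, curve x -> nonzero_vec (ev psi x) ->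
        proj_eq (ev u (ev psi x)) x].

(* The kernel of K[T][X] -> Rees(I), X_i |-> u_i Z, where Rees(I) is a
   subring of K[T][Z] = {poly K[T]}. *)
Definition reesK (G : ringTX K) :=
  mmap (@polyC (ringT K)) (fun i => u i *: 'X) G = 0.

Definition bihomog (i j : nat) (G : ringTX K) :=
  G \is j.-homog /\ forall m, G@_m \is i.-homog.

Definition constT (E : ringX K) : ringTX K := map_mpoly (@mpolyC 2 K) E.

Definition curve_equation d (E : ringX K) :=
  [/\ irreducible_elt E, E \is d.-homog,
      forall x, nonzero_vec x -> (curve x <-> E.@[x] = 0)
    & forall G, reesK (constT G) <-> multiple_of G E].

Definition mu_basis d mu (P Q : ringTX K) :=
  [/\ (mu.*2 <= d)%N,
      bihomog mu 1 P /\ reesK P,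
      bihomog (d - mu) 1 Q /\ reesK Q
    & forall G, G \is 1.-homog -> reesK G ->
        exists! ab : ringT K * ringT K, G = ab.1 *: P + ab.2 *: Q].

(* S is a minimal system of bihomogeneous generators of the ideal reesK; for
   bihomogeneous systems, irredundancy amounts to minimal cardinality. *)
Definition min_generators (S : seq (ringTX K)) :=
  (forall G, G \in S -> exists i j, bihomog i j G) /\ min_generates reesK S.

Definition part_of_min_generators (S : seq (ringTX K)) :=
  exists S', min_generators (S ++ S').

End Parametrization.

Section Multiplicity.
Variable K : closedFieldType.

(* the least degree of a monomial of f; 0 when f = 0 *)
Definition order_at0 n (f : {mpoly K[n]}) :=
  \big[minn/msize f]_(m <- msupp f) mdeg m.

(* The equation of the curve E = 0 in the affine chart X_i = x_i, in
   coordinates centered at x (the variable X_i does not occur in it). *)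
Definition local_equation (E : ringX K) (x : 'I_3 -> K) (i : 'I_3) : ringX K :=
  E \mPo [tuple (x j)%:MP + (if j == i then 0 else 'X_j) | j < 3].

Definition mult_in_chart E x i := order_at0 (local_equation E x i).

Definition very_singular mu (E : ringX K) (x : 'I_3 -> K) :=
  E.@[x] = 0 /\ exists i, x i != 0 /\ (mu < mult_in_chart E x i)%N.

Definition point001 : 'I_3 -> K := fun i => (i == ord_max)%:R.

End Multiplicity.

Section Resultant.
Variable K : closedFieldType.

(* coefficient of T_0^a T_1^b, as an element of K[X] *)
Definition coefT (a b : nat) (G : ringTX K) : ringX K :=
  map_mpoly (mcoeff [multinom nth 0%N [:: a; b] i | i < 2]) G.

(* Sylvester matrix of F, G regarded as binary forms of degrees m, n in T:
   n shifted rows of coefficients of F above m shifted rows of those of G. *)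
Definition sylvesterT m n (F G : ringTX K) : 'M[ringX K]_(n + m) :=
  col_mx
    (\matrix_(i < n, j < n + m)
       if (i <= j <= i + m)%N then coefT (j - i) (m - (j - i)) F else 0)
    (\matrix_(i < m, j < n + m)
       if (i <= j <= i + n)%N then coefT (j - i) (n - (j - i)) G else 0).

Definition resT m n (F G : ringTX K) : ringX K := \det (sylvesterT m n F G).

End Resultant.

Section OperatorDT.
Variable K : closedFieldType.

(* p^0 and p^1 are read off from P = p^1 X_0 - p^0 X_1. *)
Definition p_0 (P : ringTX K) : ringT K := - P@_U_(1).
Definition p_1 (P : ringTX K) : ringT K := P@_U_(0).

(* H is a value of D_T at G, of bidegree (i, j), for some decomposition of G *)
Definition DT mu (P : ringTX K) i j (G H : ringTX K) :=
  [/\ (2 * mu <= i + 1)%N, bihomog i j G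
    & exists G0 G1 : ringTX K,
      [/\ bihomog (i - mu) j G0, bihomog (i - mu) j G1,
          G = p_0 P *: G0 + p_1 P *: G1
        & H = 'X_0 * G0 + 'X_1 * G1]].

(* (k - j) mu + r, which is nonnegative for j < k when mu > 0 and r >= -1 *)
Definition Fdeg (mu k : nat) (r : int) (j : nat) : nat :=
  absz ((k%:Z - j%:Z) * mu%:Z + r).

(* F j stands for F_{(k-j)mu+r, j}, for 1 <= j <= k-1 *)
Definition F_sequence mu k r (P Q : ringTX K) (F : nat -> ringTX K) :=
  F 1%N = Q /\
  forall j, (2 <= j <= k - 1)%N ->
    DT mu P (Fdeg mu k r j.-1) j.-1 (F j.-1) (F j).

End OperatorDT.

(* Main.v *)
From Stdlib Require Classical_Prop.
From HB Require Import structures.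
Require Import Defs.
From mathcomp Require Import all_boot all_order all_algebra.
From mathcomp Require Import mpoly.
From mathcomp Require Import zify.

Set Implicit Arguments.
Unset Strict Implicit.
Unset Printing Implicit Defensive.

Import GRing.Theory.
Local Open Scope ring_scope.

(** The moving line [P] passes through (0:0:1), so that
    [P = p_1 X_0 - p_0 X_1] and its points are the [(p_0 : p_1 : x)].
    Restricting a form [G] in the [X_i] to this line gives a polynomial in [x]
    over [K[T]].  Since [p_0] and [p_1] are coprime, the forms whose restriction
    vanishes are the multiples of [P] ([on_moving_line_eq0]); in particular [P]
    is prime.  Moreover [u_0 = h p_0] and [u_1 = h p_1] for some [h], coprime to
    [u_2].  Hence [G], of bidegree [(i, j)] and with restriction
    [\sum_b g_b x^b], follows the curve exactly when
    [\sum_b g_b h^(j-b) u_2^b = 0], and everything can be read off from the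
    coefficients [g_b].

    If [G] follows the curve and is not a multiple of [P], then [u_2] divides
    the first nonzero [g_b].  Comparison of degrees gives [d <= i + mu j], which
    is the third part ([low_degree_multiple]).  The operator [D_T] exchanges
    [p_0, p_1] for [X_0, X_1], and these agree on the line.  So all the [F_j]
    have the same restriction as [Q], which is not zero ([F_properties]); this
    is the first part.

    The resultant of [P] and [F_j] follows the curve, since it lies in their
    ideal up to a power of the variables [T] ([resT_eliminates]), and it has
    degree [d], the degree of [E].  It is not zero: a vanishing Sylvester
    determinant yields a relation [x P + y F_j = 0] where [y] has degree less
    than [mu] in [T], whereas the prime [P], not dividing [F_j], must divide [y]
    ([resT_moving_line_neq0]).  This is the second part.

    The same argument shows that [P] does pass through (0:0:1).  Let [L] be the
    moving line through (0:0:1) that follows the curve.  The resultant of [L]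
    and [P] is a multiple of [E], and so it vanishes to order more than [mu] at
    (0:0:1), whereas its order would be [mu] if [X_2] occurred in [P]
    ([very_singular_mu_basis]).

    For the last part, the ideal is bihomogeneous and finitely generated, by
    Hilbert's basis theorem.  Given a system of elements of distinct
    bidegrees, none of which lies in the ideal generated by the elements of
    lower bidegree, a bihomogeneous complement of least cardinality makes it a
    minimal system of generators ([extend_to_minimal_generators]).  Below [E]
    and [P] there is only 0, and below [F_j] only multiples of [P], by the
    third part. *)

(** * Divisibility and substitution *)

Section Multiples.
Variable A : comUnitRingType.
Implicit Types a b c : A.

Lemma multiple_of0 b : multiple_of 0 b.
Proof. by exists 0; rewrite mul0r. Qed.

Lemma multiple_ofD a a' b :
  multiple_of a b -> multiple_of a' b -> multiple_of (a + a') b.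
Proof. by move=> [c ->] [c' ->]; exists (c + c'); rewrite mulrDl. Qed.

Lemma multiple_ofMl c a b : multiple_of a b -> multiple_of (c * a) b.
Proof. by move=> [x ->]; exists (c * x); rewrite mulrA. Qed.

Lemma multiple_ofMr c a b : multiple_of a b -> multiple_of (a * c) b.
Proof. by rewrite mulrC; apply: multiple_ofMl. Qed.

Lemma multiple_ofN a b : multiple_of a b -> multiple_of (- a) b.
Proof. by move=> [x ->]; exists (- x); rewrite mulNr. Qed.

Lemma multiple_of_refl b : multiple_of b b.
Proof. by exists 1; rewrite mul1r. Qed.

Lemma multiple_of_sum (I : eqType) (r : seq I) (F : I -> A) b :
  (forall i, i \in r -> multiple_of (F i) b) ->
  multiple_of (\sum_(i <- r) F i) b.
Proof.
move=> h; rewrite big_seq; apply: (big_ind (fun x => multiple_of x b)) => //.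
- exact: multiple_of0.
- by move=> x y; apply: multiple_ofD.
Qed.

Lemma multiple_of_subX a b c n :
  multiple_of (a - b) c -> multiple_of (a ^+ n - b ^+ n) c.
Proof. by move=> h; rewrite subrXX; apply: multiple_ofMr. Qed.

Lemma multiple_of_sub_mul a a' b b' c :
  multiple_of (a - b) c -> multiple_of (a' - b') c ->
  multiple_of (a * a' - b * b') c.
Proof.
move=> h h'; have -> : a * a' - b * b' = (a - b) * a' + b * (a' - b').
  by rewrite mulrBl mulrBr addrA subrK.
by apply: multiple_ofD; [apply: multiple_ofMr | apply: multiple_ofMl].
Qed.

Lemma multiple_of_sub_mmap n (R : nzRingType) (f : {additive R -> A})
    (h1 h2 : 'I_n -> A) c (p : {mpoly R[n]}) :
  (forall i, multiple_of (h1 i - h2 i) c) ->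
  multiple_of (mmap f h1 p - mmap f h2 p) c.
Proof.
move=> h; rewrite /mmap -sumrB; apply: multiple_of_sum => m _.
rewrite -mulrBr; apply: multiple_ofMl; rewrite /mmap1.
apply: (big_ind2 (fun x y => multiple_of (x - y) c)).
- by rewrite subrr; apply: multiple_of0.
- by move=> x y x' y'; apply: multiple_of_sub_mul.
- by move=> i _; apply: multiple_of_subX.
Qed.

End Multiples.

Lemma mmap_eq n (R S : nzRingType) (f : R -> S) (h1 h2 : 'I_n -> S)
    (p : {mpoly R[n]}) : h1 =1 h2 -> mmap f h1 p = mmap f h2 p.
Proof.
by move=> h; apply: eq_bigr => m _; congr (_ * _); apply: mmap1_eq.
Qed.

Lemma rmorph_mmap n (R : nzRingType) (S S' : nzRingType) (f : R -> S)
    (h : 'I_n -> S) (g : {rmorphism S -> S'}) (p : {mpoly R[n]}) :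
  g (mmap f h p) = mmap (g \o f) (g \o h) p.
Proof.
rewrite /mmap rmorph_sum; apply: eq_bigr => m _.
rewrite rmorphM /mmap1 rmorph_prod; congr (_ * _).
by apply: eq_bigr => i _; rewrite rmorphXn.
Qed.

Lemma mmap_id n (R : nzRingType) (p : {mpoly R[n]}) :
  mmap (@mpolyC n R) (fun i => 'X_i) p = p.
Proof.
rewrite [RHS]mpolyE; apply: eq_bigr => m _.
by rewrite mmap1_id mul_mpolyC.
Qed.

Lemma pihomogM n (R : nzRingType) i j (f g : {mpoly R[n]}) :
  g \is j.-homog -> pihomog mdeg (i + j) (f * g) = pihomog mdeg i f * g.
Proof.
move=> hg; rewrite [X in X * g](@pihomog_partitionE _ _ mdeg (msize f)) //.
rewrite mulr_suml linear_sum /= {3}/pihomog.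
rewrite (eq_bigr (fun k : 'I_(msize f) =>
   if val k == i then pihomog mdeg i f * g else 0)); last first.
  move=> k _; have hk := dhomogM (pihomogP mdeg k f) hg.
  case: eqP => [<-|/eqP ne]; first by rewrite pihomog_dE.
  by rewrite (pihomog_ne0 _ hk) // eqn_add2r.
rewrite -/(pihomog mdeg i f) -big_mkcond /=.
have [lt|le] := ltnP i (msize f).
  by rewrite (big_pred1 (Ordinal lt)).
rewrite big_pred0 => [|k]; last by rewrite (ltn_eqF (leq_trans (ltn_ord k) le)).
rewrite pihomogE big_seq_cond big_pred0 ?mul0r // => m.
apply: contraTF le => /andP[/msize_mdeg_lt + /eqP mi].
by rewrite mi -ltnNge.
Qed.

Lemma form0P n (R : nzRingType) (f : {mpoly R[n]}) :
  f \is 0.-homog -> f = (f@_0)%:MP.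
Proof.
move=> /dhomogP hf; apply: msize1_polyC; rewrite msizeE.
by apply/bigmax_leqP_seq => m /hf ->.
Qed.

Lemma form_dvd_eq0 n (R : idomainType) i j (f x : {mpoly R[n]}) :
  f \is i.-homog -> x \is j.-homog -> f != 0 -> (j < i)%N ->
  multiple_of x f -> x = 0.
Proof.
move=> hf hx f0 ji [c e]; apply/eqP; case: eqP => // /eqP xn.
have cn : c != 0 by apply: contraNneq xn => z; rewrite e z mul0r.
move: (msizeM cn f0); rewrite -e -(mlead_deg xn) -(mlead_deg f0) -(mlead_deg cn).
rewrite (dhomog_mf hf (mlead_supp f0)) (dhomog_mf hx (mlead_supp xn)).
rewrite addSn /= addnS => -[ej].
by move: ji; rewrite ej ltnNge leq_addl.
Qed.

Section Lines.
Variables (A : comNzRingType) (n : nat).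
Implicit Types (t : 'I_n -> A) (f : {mpoly A[n]}).

(** Restriction to the line through the origin and [t].  It reads off the
    kernel of the Rees algebra when [t] is a vector of polynomials, and it is
    a morphism to an integral domain when [A] is one. *)
Definition on_line t : {mpoly A[n]} -> {poly A} :=
  mmap (@polyC A) (fun i => t i *: 'X).

HB.instance Definition _ t := GRing.RMorphism.on (on_line t).

Lemma on_lineX t i : on_line t 'X_i = t i *: 'X.
Proof. by rewrite /on_line mmapX mmap1U. Qed.

Lemma on_lineZ t c f : on_line t (c *: f) = c *: on_line t f.
Proof. by rewrite /on_line mmapZ mul_polyC. Qed.

Lemma on_lineC t c : on_line t c%:MP = c%:P.
Proof. by rewrite /on_line mmapC. Qed.

Lemma horner1_on_line t f : (on_line t f).[1] = f.@[t].
Proof.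
rewrite -[LHS]/(horner_eval 1 (on_line t f)) rmorph_mmap /=.
rewrite /meval /mmap; apply: eq_bigr => m _ /=; rewrite /horner_eval hornerC.
congr (_ * _); apply: mmap1_eq => i /=.
by rewrite /horner_eval hornerZ hornerX mulr1.
Qed.

Lemma on_line_form t i f : f \is i.-homog -> on_line t f = f.@[t] *: 'X^i.
Proof.
move=> /dhomogP hf; rewrite mevalE scaler_suml; apply: eq_big_seq => m mf.
rewrite -mul_polyC polyCM -mulrA; congr (_ * _).
have /= <- := hf _ mf; rewrite mdegE /mmap1 rmorph_prod -prodrXr -big_split /=.
by apply: eq_bigr => k _; rewrite exprZn -mul_polyC rmorphXn.
Qed.

Lemma coef_on_line t f j : (on_line t f)`_j = (pihomog mdeg j f).@[t].
Proof.
have [lt|le] := ltnP j (msize f); last first.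
  rewrite pihomogE big1_seq ?meval0 => [|m /andP[/eqP mj /msize_mdeg_lt]]; last first.
    by rewrite mj ltnNge le.
  rewrite coef_sum big1_seq // => m /andP[_ mf]; rewrite coefCM.
  have hm := @on_line_form t (mdeg m) 'X_[m].
  have := hm; rewrite dhomogX eqxx /on_line mmapX => -> //.
  rewrite coefZ coefXn gtn_eqF ?mulr0 //.
  by rewrite (leq_trans (msize_mdeg_lt mf)).
rewrite {1}[f](pihomog_partitionE (leqnn (msize f))) rmorph_sum coef_sum.
rewrite (bigD1 (Ordinal lt)) //= big1 ?addr0 => [|k].
  by rewrite (on_line_form t (pihomogP _ _ _)) coefZ coefXn eqxx mulr1.
rewrite -val_eqE /= => kj; rewrite (on_line_form t (pihomogP _ _ _)).
by rewrite coefZ coefXn eq_sym (negPf kj) mulr0.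
Qed.

End Lines.

(** * Binary forms over an algebraically closed field *)

Section BinaryForms.
Variable K : closedFieldType.
Implicit Types (f g x : ringT K) (t : 'I_2 -> K).

Definition no_common_zero f g :=
  forall t, nonzero_vec t -> f.@[t] = 0 -> g.@[t] != 0.

Definition linear_form t : ringT K := t 1 *: 'X_0 - t 0 *: 'X_1.

Lemma ord2_cases (i : 'I_2) : i = 0 \/ i = 1.
Proof.
by case: i => [[|[|//]] hi]; [left | right]; apply/val_inj.
Qed.

Lemma dhomog_linear_form t : linear_form t \is 1.-homog.
Proof. by rewrite rpredB // rpredZ // dhomogX /= mdeg1. Qed.

Lemma linear_form_neq0 t : nonzero_vec t -> linear_form t != 0.
Proof.
move=> [i ti]; apply/eqP => /mpolyP e.
case: (ord2_cases i) => ii; subst i.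
  have := e U_(1%R)%MM; rewrite mcoeffB !mcoeffZ !mcoeffXU /= mcoeff0.
  by move/eqP; rewrite mulr0 mulr1 sub0r oppr_eq0 (negPf ti).
have := e U_(0%R)%MM; rewrite mcoeffB !mcoeffZ !mcoeffXU /= mcoeff0.
by move/eqP; rewrite mulr0 mulr1 subr0 (negPf ti).
Qed.

(** Modulo the linear form vanishing at [t] each variable is a multiple of a
    single one, which inverts the restriction to the line. *)
Lemma on_line_eq0 t f :
  nonzero_vec t -> on_line t f = 0 -> multiple_of f (linear_form t).
Proof.
move=> [i ti] f0.
pose back (p : {poly K}) : ringT K :=
  (map_poly (@mpolyC 2 K) p).[(t i)^-1 *: 'X_i].
have: multiple_of (mmap (@mpolyC 2 K) (fun k => 'X_k) f
   - mmap (@mpolyC 2 K) (fun k => (t k / t i) *: 'X_i) f) (linear_form t).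
  apply: multiple_of_sub_mmap => k.
  have [->|ki] := eqVneq k i; first by
    rewrite divff // scale1r subrr; apply: multiple_of0.
  have -> : 'X_k - (t k / t i) *: 'X_i =
      (t i)^-1 *: (t i *: 'X_k - t k *: 'X_i) :> ringT K.
    by rewrite scalerBr !scalerA mulVf // scale1r mulrC.
  rewrite -mul_mpolyC; apply: multiple_ofMl; rewrite /linear_form.
  case: (ord2_cases i) ki => ->; case: (ord2_cases k) => -> // _.
    by rewrite -opprB; apply/multiple_ofN/multiple_of_refl.
  exact: multiple_of_refl.
rewrite mmap_id; have -> : mmap (@mpolyC 2 K)
    (fun k => (t k / t i) *: 'X_i) f = back (on_line t f).
  rewrite /back -[RHS]/(horner_eval ((t i)^-1 *: 'X_i)
    (map_poly (@mpolyC 2 K) (on_line t f))) !rmorph_mmap /=.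
  rewrite /mmap; apply: eq_bigr => m _ /=; rewrite /horner_eval.
  rewrite map_polyC hornerC; congr (_ * _); apply: mmap1_eq => k /=.
  by rewrite linearZ /= map_polyX hornerZ hornerX mul_mpolyC scalerA.
by rewrite f0 /back rmorph0 horner0 subr0.
Qed.

(** A nonconstant dehomogenized form has a root; a constant one comes from a
    multiple of a power of [X_1], which vanishes at (1, 0). *)
Lemma form_has_zero i f :
  (0 < i)%N -> f \is i.-homog -> exists t, nonzero_vec t /\ f.@[t] = 0.
Proof.
move=> i0 /dhomogP hf.
pose p := mmap (@polyC K) (fun k : 'I_2 => if k == 0 then 'X else 1) f.
have [/eqP sp|/closed_rootP[x px]] := boolP (size p == 1).
  exists (fun k => (k == 0)%:R); split.
    by exists 0; rewrite eqxx oner_eq0.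
  have <- : p`_i = 0 by rewrite nth_default // sp.
  rewrite mevalE coef_sum; apply: eq_big_seq => m mf.
  have := hf _ mf; rewrite /= mdegE !big_ord_recl big_ord0 addn0 => mi.
  rewrite coefCM /mmap1 !big_ord_recl !big_ord0 /= !expr1n !mulr1 mul1r.
  rewrite coefXn -mi -[X in (_ == X)%N]addn0 eq_sym eqn_add2l expr0n.
  by rewrite eq_sym.
exists (fun k => if k == 0 then x else 1); split.
  by exists 1; rewrite /= oner_eq0.
move: px; rewrite /root => /eqP <-.
rewrite -[RHS]/(horner_eval x p) rmorph_mmap /= /meval /mmap.
apply: eq_bigr => m _ /=; rewrite /horner_eval hornerC; congr (_ * _).
by apply: mmap1_eq => k /=; case: ifP; rewrite ?hornerX ?hornerC.
Qed.

Lemma form_dvd_linear i f t : nonzero_vec t -> f \is i.+1.-homog ->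
  f.@[t] = 0 -> exists2 g, g \is i.-homog & f = g * linear_form t.
Proof.
move=> tn hf f0.
have [|g fg] := @on_line_eq0 t f tn; first by rewrite (on_line_form _ hf) f0 scale0r.
exists (pihomog mdeg i g); first exact: pihomogP.
by rewrite -(pihomogM i g (dhomog_linear_form t)) addn1 -fg pihomog_dE.
Qed.

(** Euclid's lemma.  Peel off the linear factors of [f] one at a time: each is
    prime and does not divide [g]. *)
Lemma form_coprime_dvd i f g x : f \is i.-homog -> f != 0 ->
  no_common_zero f g -> multiple_of (g * x) f -> multiple_of x f.
Proof.
elim: i f x => [|i IH] f x hf f0 hfg [c e].
  exists (x * (f@_0)^-1%:MP); rewrite {2}(form0P hf) -mulrA -mpolyCM mulVf ?mulr1 //.
  by apply: contraNneq f0 => z; rewrite (form0P hf) z mpolyC0.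
have [t [tn ft]] := form_has_zero (ltn0Sn i) hf.
have [f' hf' ef] := form_dvd_linear tn hf ft.
have [x' ex] : multiple_of x (linear_form t).
  apply: on_line_eq0 => //; apply/eqP.
  have: on_line t (g * x) == 0.
    by rewrite e rmorphM /= (on_line_form _ hf) ft scale0r mulr0.
  rewrite rmorphM mulf_eq0 => /orP[/eqP gl|//].
  by have := hfg t tn ft; rewrite -horner1_on_line gl horner0 eqxx.
have ln := linear_form_neq0 tn.
have [y ey] : multiple_of x' f'.
  apply: IH => //.
  - by apply: contraNneq f0 => z; rewrite ef z mul0r.
  - by move=> s sn s0; apply: hfg => //; rewrite ef mevalM s0 mul0r.
  - by exists c; apply: (mulIf ln); rewrite -mulrA -ex e ef mulrA.
by exists y; rewrite ex ey ef mulrA.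
Qed.

(** Common zeros are removed by dividing both forms by the corresponding linear
    form. *)
Lemma form_gcd i f g : f \is i.-homog -> g \is i.-homog -> f != 0 ->
  exists e h f' g', [/\ f' \is e.-homog, g' \is e.-homog,
    f = h * f', g = h * g' & no_common_zero f' g'].
Proof.
elim: i f g => [|i IH] f g hf hg f0.
  exists 0%N, 1, f, g; split; rewrite ?mul1r // => t _.
  rewrite (form0P hf) mevalC => z.
  by move: f0; rewrite (form0P hf) z mpolyC0 eqxx.
have [[t [tn [ft gt]]]|nz] := Classical_Prop.classic
    (exists t, nonzero_vec t /\ f.@[t] = 0 /\ g.@[t] = 0); last first.
  exists i.+1, 1, f, g; split; rewrite ?mul1r // => t tn ft; apply/eqP => gt.
  by apply: nz; exists t.
have [f' hf' ef] := form_dvd_linear tn hf ft.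
have [g' hg' eg] := form_dvd_linear tn hg gt.
have f'0 : f' != 0 by apply: contraNneq f0 => z; rewrite ef z mul0r.
have [e [h [a [b [ha hb ea eb ab]]]]] := IH f' g' hf' hg' f'0.
exists e, (h * linear_form t), a, b; split=> //.
  by rewrite ef ea mulrAC.
by rewrite eg eb mulrAC.
Qed.

End BinaryForms.

(** * Restriction to a moving line through (0:0:1) *)

Section Coordinates.

Lemma ord3_cases (i : 'I_3) : [\/ i = 0, i = 1 | i = ord_max].
Proof.
by case: i => [[|[|[|//]]] hi];
  [constructor 1 | constructor 2 | constructor 3]; apply/val_inj.
Qed.

Definition coord3 (B : Type) (a b c : B) (i : 'I_3) : B :=
  if i == 0 then a else if i == 1 then b else c.

Lemma mmap1_coord3 (B : nzRingType) (a b c : B) (m : 'X_{1..3}) :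
  mmap1 (coord3 a b c) m = a ^+ m 0 * b ^+ m 1 * c ^+ m ord_max.
Proof.
rewrite /mmap1 !big_ord_recl big_ord0 mulr1 /coord3 /= mulrA.
have -> : ord_max = lift ord0 (lift ord0 ord0) :> 'I_3 by apply/val_inj.
by have -> : 1 = lift ord0 ord0 :> 'I_3 by apply/val_inj.
Qed.

Lemma mdeg3 (m : 'X_{1..3}) : mdeg m = (m 0%R + m 1%R + m ord_max)%N.
Proof.
rewrite mdegE !big_ord_recl big_ord0 addn0 addnA.
have -> : ord_max = lift ord0 (lift ord0 ord0) :> 'I_3 by apply/val_inj.
by have -> : 1 = lift ord0 ord0 :> 'I_3 by apply/val_inj.
Qed.

End Coordinates.

Section MovingLine.
Variable A : idomainType.
Implicit Types (q : A) (G : {mpoly A[3]}).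

Definition moving_line q0 q1 : {mpoly A[3]} := q1 *: 'X_0 - q0 *: 'X_1.

(** The line [moving_line q0 q1] joins (0:0:1) to (q0:q1:0); its points
    (q0:q1:x) are parametrized by the variable of the target. *)
Definition on_moving_line q0 q1 : {mpoly A[3]} -> {poly A} :=
  mmap (@polyC A) (coord3 q0%:P q1%:P 'X).

HB.instance Definition _ q0 q1 := GRing.RMorphism.on (on_moving_line q0 q1).

Lemma on_moving_lineX q0 q1 i :
  on_moving_line q0 q1 'X_i = coord3 q0%:P q1%:P 'X i.
Proof. by rewrite /on_moving_line mmapX mmap1U. Qed.

Lemma on_moving_lineZ q0 q1 c G :
  on_moving_line q0 q1 (c *: G) = c *: on_moving_line q0 q1 G.
Proof. by rewrite /on_moving_line mmapZ mul_polyC. Qed.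

Lemma on_moving_line_self q0 q1 : on_moving_line q0 q1 (moving_line q0 q1) = 0.
Proof.
rewrite rmorphB /= !on_moving_lineZ !on_moving_lineX /coord3 /=.
by rewrite -!mul_polyC -!polyCM mulrC subrr.
Qed.

Lemma on_moving_line_relation q0 q1 G x y : on_moving_line q0 q1 G != 0 ->
  y * 'X_ord_max * G = - (x * moving_line q0 q1) -> on_moving_line q0 q1 y = 0.
Proof.
move=> Gn /(congr1 (on_moving_line q0 q1)) /eqP.
rewrite rmorphN !rmorphM /= on_moving_line_self mulr0 oppr0 !mulf_eq0 (negPf Gn).
by rewrite orbF on_moving_lineX /coord3 /= polyX_eq0 orbF => /eqP.
Qed.

Lemma coef_on_moving_line q0 q1 G b :
  (on_moving_line q0 q1 G)`_b =
  \sum_(m <- msupp G) G@_m * (q0 ^+ m 0 * q1 ^+ m 1) * (b == m ord_max)%:R.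
Proof.
rewrite coef_sum; apply: eq_bigr => m _.
rewrite mmap1_coord3 -!rmorphXn -!rmorphM /= mulrA -polyCM coefCM coefXn.
by rewrite mulrA.
Qed.

Lemma size_on_moving_line q0 q1 G j :
  G \is j.-homog -> (size (on_moving_line q0 q1 G) <= j.+1)%N.
Proof.
move=> /dhomogP hG; apply/leq_sizeP => b jb.
rewrite coef_on_moving_line big_seq big1 // => m mG.
case: eqP => [bm|]; last by rewrite mulr0.
have := hG _ mG; rewrite /= mdeg3 => ej.
by move: jb; rewrite bm -ej ltnNge leq_addl.
Qed.

(** A form in the [X_i] is recovered from its restriction to the affine line
    by homogenization. *)
Lemma mmap_on_moving_line (B : comNzRingType) (phi : {rmorphism A -> B})
    q0 q1 (v w : B) j G : G \is j.-homog ->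
  mmap phi (coord3 (phi q0 * v) (phi q1 * v) w) G =
  \sum_(b < j.+1) phi (on_moving_line q0 q1 G)`_b * v ^+ (j - b) * w ^+ b.
Proof.
move=> /dhomogP hG.
under eq_bigr do rewrite coef_on_moving_line rmorph_sum !mulr_suml.
rewrite exchange_big /=; apply: eq_big_seq => m mG.
have := hG _ mG; rewrite /= mdeg3 => ej.
have mj : (m ord_max < j.+1)%N by rewrite ltnS -ej leq_addl.
rewrite (bigD1 (Ordinal mj)) //= eqxx mulr1 big1 ?addr0; last first.
  move=> b; rewrite -val_eqE /= => /negPf ->.
  by rewrite mulr0 rmorph0 !mul0r.
rewrite mmap1_coord3 !exprMn -ej addnK exprD !rmorphM !rmorphXn /=.
by rewrite [_ * (phi q1 ^+ _ * _)]mulrACA !mulrA.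
Qed.

Lemma multiple_of_coefs (a : A) G :
  (forall m, multiple_of G@_m a) -> multiple_of G a%:MP.
Proof.
move=> h; rewrite [G]mpolyE; apply: multiple_of_sum => m _.
have [c ->] := h m; exists (c *: 'X_[m]).
by rewrite [RHS]mulrC mul_mpolyC scalerA [c * a]mulrC.
Qed.

Variables q0 q1 : A.
Hypothesis q1_neq0 : q1 != 0.
Hypothesis q1_coprime : forall x, multiple_of (q0 * x) q1 -> multiple_of x q1.

(** [q1, q0 X_1] is a regular sequence. *)
Lemma moving_line_regular G :
  multiple_of (G * (q0 *: 'X_1)) q1%:MP -> multiple_of G q1%:MP.
Proof.
move=> [c ec]; apply: multiple_of_coefs => m.
apply: q1_coprime; exists c@_(U_(1%R) + m).
move: (congr1 (mcoeff (U_(1%R) + m)) ec).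
by rewrite -scalerAr mcoeffZ mcoeffMX [c * _]mulrC mcoeffCM [c@_ _ * _]mulrC.
Qed.

(** Modulo the line, [q1 X_0 = q0 X_1], so that a power of [q1] times [G] is
    the homogenized restriction of [G]; then [q1] is cancelled. *)
Lemma on_moving_line_eq0 j G : G \is j.-homog ->
  on_moving_line q0 q1 G = 0 -> multiple_of G (moving_line q0 q1).
Proof.
move=> hG G0; set L := moving_line q0 q1.
have cancel n c : q1%:MP ^+ n * G = c * L -> multiple_of G L.
  elim: n c => [|n IH] c; first by rewrite mul1r => ->; exists c.
  move=> ec; have [c' ec'] : multiple_of c q1%:MP.
    apply: moving_line_regular.
    have -> : c * (q0 *: 'X_1) = c * (q1 *: 'X_0) - c * L.
      by rewrite -mulrBr /L /moving_line opprB addrC subrK.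
    rewrite -ec exprS -[q1 *: _]mul_mpolyC; apply: multiple_ofD.
      by exists (c * 'X_0); rewrite -mulrA; congr (_ * _); rewrite mulrC.
    by exists (- (q1%:MP ^+ n * G)); rewrite mulNr -mulrA mulrC.
  apply: (IH c'); apply: (@mulfI _ q1%:MP); first by rewrite mpolyC_eq0.
  by rewrite mulrA -exprS ec ec' mulrA [_ * q1%:MP]mulrC.
have scaled : mmap (@mpolyC 3 A) (fun i => q1 *: 'X_i) G = q1%:MP ^+ j * G.
  rewrite [in RHS](mpolyE G) mulr_sumr; apply: eq_big_seq => m mG.
  have /= <- := dhomog_mf hG mG.
  rewrite /mmap1 mpolyXE_id mdegE -prodrXr -mul_mpolyC mulrCA -big_split /=.
  by congr (_ * _); apply: eq_bigr => i _; rewrite -exprMn mul_mpolyC.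
have restr : mmap (@mpolyC 3 A) (coord3 (q0 *: 'X_1) (q1 *: 'X_1)
    (q1 *: 'X_ord_max)) G = 0.
  rewrite -[q0 *: _]mul_mpolyC -[q1 *: 'X_1]mul_mpolyC.
  rewrite (mmap_on_moving_line _ _ _ _ _ hG) G0 big1 // => b _.
  by rewrite coef0 rmorph0 !mul0r.
have [c] : multiple_of (q1%:MP ^+ j * G) L; last exact: cancel.
rewrite -scaled -[mmap _ _ _]subr0 -restr; apply: multiple_of_sub_mmap => i.
case: (ord3_cases i) => ->; rewrite /coord3 /= ?subrr;
  by [apply: multiple_of_refl | apply: multiple_of0].
Qed.

End MovingLine.

Section FormsOnMovingLine.
Variable K : closedFieldType.
Variables (e : nat) (q0 q1 : ringT K).
Hypotheses (hq0 : q0 \is e.-homog) (hq1 : q1 \is e.-homog).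
Implicit Types G : ringTX K.

Lemma dhomog_on_moving_line i j G b : bihomog i j G ->
  (on_moving_line q0 q1 G)`_b \is (i + e * (j - b)).-homog.
Proof.
move=> [/dhomogP hG hGi]; rewrite coef_on_moving_line big_seq.
apply: rpred_sum => m mG; case: eqP => [->|_]; last by rewrite mulr0 rpred0.
have := hG _ mG; rewrite /= mdeg3 => <-; rewrite addnK mulr1 mulnDr.
by apply: dhomogM; rewrite ?hGi //; apply: dhomogM; apply: dhomogMn.
Qed.

End FormsOnMovingLine.

(** * Resultants of forms in T *)

Section Expansion.
Variable K : closedFieldType.
Implicit Types (f : ringT K) (G : ringTX K).

Definition monT (a b : nat) : ringT K := 'X_0 ^+ a * 'X_1 ^+ b.

(** The exponent by which [coefT] selects coefficients. *)
Definition mon2 (a b : nat) : 'X_{1..2} :=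
  [multinom nth 0%N [:: a; b] i | i < 2].

Lemma mdeg2 (m : 'X_{1..2}) : mdeg m = (m 0%R + m 1%R)%N.
Proof.
rewrite mdegE !big_ord_recl big_ord0 addn0.
by have -> : 1 = lift ord0 ord0 :> 'I_2 by apply/val_inj.
Qed.

Lemma mon2_eqE a b (m : 'X_{1..2}) :
  (mon2 a b == m) = (a == m 0) && (b == m 1).
Proof.
apply/eqP/andP => [<-|[/eqP ea /eqP eb]].
  by rewrite !mnmE.
by apply/mnmP => i; case: (ord2_cases i) => ->; rewrite mnmE.
Qed.

Lemma monTE a b : monT a b = 'X_[mon2 a b].
Proof.
rewrite [RHS]mpolyXE_id !big_ord_recl big_ord0 mulr1 !mnmE /monT /=.
by have -> : 1 = lift ord0 ord0 :> 'I_2 by apply/val_inj.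
Qed.

Lemma monT_neq0 a b : monT a b != 0.
Proof.
rewrite monTE; apply/eqP => /(congr1 (mcoeff (mon2 a b))).
by rewrite mcoeffX eqxx mcoeff0 => /eqP; rewrite oner_eq0.
Qed.

Lemma monTD a b a' b' : monT (a + a') (b + b') = monT a b * monT a' b'.
Proof. by rewrite /monT !exprD mulrACA. Qed.

Lemma dhomog_monT a b : monT a b \is (a + b).-homog.
Proof. by rewrite monTE dhomogX /= mdeg2 !mnmE. Qed.

Lemma form_expansion n f : f \is n.-homog ->
  f = \sum_(l < n.+1) f@_(mon2 l (n - l)) *: monT l (n - l).
Proof.
move=> hf; apply/mpolyP => m; rewrite linear_sum /=.
under eq_bigr do rewrite mcoeffZ monTE mcoeffX mon2_eqE.
have [mn|mn] := eqVneq (mdeg m) n; last first.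
  rewrite (dhomog_nemf_coeff hf) ?big1 // => l _.
  case: andP; rewrite ?mulr0 // => -[/eqP l0 /eqP l1].
  by case/eqP: mn; rewrite mdeg2 -l0 -l1 subnKC // -ltnS.
have ln : (m 0%R < n.+1)%N by rewrite ltnS -mn mdeg2 leq_addr.
have lm : (n - m 0%R = m 1%R)%N by rewrite -mn mdeg2 addKn.
rewrite (bigD1 (Ordinal ln)) //= lm !eqxx mulr1 big1 ?addr0.
  by congr (f@__); apply/esym/eqP; rewrite mon2_eqE !eqxx.
by move=> l; rewrite -val_eqE /= => /negPf ->; rewrite mulr0.
Qed.

HB.instance Definition _ :=
  GRing.RMorphism.copy (@constT K) (map_mpoly (@mpolyC 2 K)).

Lemma mcoeff_coefT a b G m : (coefT a b G)@_m = G@_m@_(mon2 a b).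
Proof. by rewrite /coefT mcoeff_map_mpoly. Qed.

Lemma mcoeff_constT_mul (E : ringX K) f m :
  (constT E * f%:MP)@_m = E@_m *: f.
Proof. by rewrite mulrC mcoeffCM /constT mcoeff_map_mpoly mulrC mul_mpolyC. Qed.

Lemma T_expansion n G : (forall m, G@_m \is n.-homog) ->
  G = \sum_(l < n.+1) constT (coefT l (n - l) G) * (monT l (n - l))%:MP.
Proof.
move=> hG; apply/mpolyP => m; rewrite linear_sum /= [LHS](form_expansion (hG m)).
by apply: eq_bigr => l _; rewrite mcoeff_constT_mul mcoeff_coefT.
Qed.

Lemma coefT_inj n (a : nat -> ringX K) :
  \sum_(i < n) constT (a i) * (monT i (n.-1 - i))%:MP = 0 ->
  forall i, (i < n)%N -> a i = 0.
Proof.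
move=> s0 i lt; apply/mpolyP => m.
move: (congr1 (mcoeff (mon2 i (n.-1 - i)) \o mcoeff m) s0) => /=.
rewrite !linear_sum /= !mcoeff0 (bigD1 (Ordinal lt)) //= big1 ?addr0.
  by rewrite mcoeff_constT_mul mcoeffZ monTE mcoeffX eqxx mulr1.
move=> l; rewrite -val_eqE /= => /negPf li.
by rewrite mcoeff_constT_mul mcoeffZ monTE mcoeffX mon2_eqE mnmE /= li mulr0.
Qed.

End Expansion.

Lemma sum_window (V : nmodType) (a : nat -> V) i m N : (i + m < N)%N ->
  \sum_(j < N) (if (i <= j <= i + m)%N then a j else 0) =
  \sum_(l < m.+1) a (i + l)%N.
Proof.
move=> iN; rewrite -(big_mkord xpredT (fun j => if (i <= j <= i + m)%N then a j else 0)).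
rewrite -(big_mkord xpredT (fun l => a (i + l)%N)).
rewrite (big_cat_nat (n := i)) //= ?(leq_trans (leq_addr m i)) 1?ltnW //.
rewrite (big_cat_nat (n := (i + m).+1) (m := i)) //=; last exact: leqW (leq_addr _ _).
rewrite big_nat big1 ?add0r => [|j /andP[_ ji]]; last by rewrite leqNgt ji.
rewrite [X in _ + X]big_nat [X in _ + X]big1 ?addr0 => [|j /andP[ij _]]; last first.
  by rewrite [(j <= _)%N]leqNgt ij andbF.
rewrite -{1}[i]add0n big_addn subSn ?leq_addr // addKn.
by apply: eq_big_nat => l /andP[_ lm]; rewrite addnC leq_addr leq_add2l -ltnS lm.
Qed.

Section Sylvester.
Variable K : closedFieldType.
Variables (m n : nat) (F G : ringTX K).

Lemma dhomog_coefT a b j (H : ringTX K) :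
  H \is j.-homog -> coefT a b H \is j.-homog.
Proof.
move=> hH; apply/dhomogP => k; rewrite mcoeff_msupp mcoeff_coefT => nz.
apply/eqP; apply: contraNT nz => /(dhomog_nemf_coeff hH) ->.
by rewrite mcoeff0.
Qed.

Lemma dhomog_det (R : comNzRingType) (k N : nat) (M : 'M[{mpoly R[k]}]_N)
    (w : 'I_N -> nat) : (forall i j, M i j \is (w i).-homog) ->
  \det M \is ((\sum_i w i)%N).-homog.
Proof.
move=> hM; apply: rpred_sum => s _.
rewrite -signr_odd mulr_sign; set p := \prod_i _.
suff hp : p \is ((\sum_i w i)%N).-homog by case: ifP; rewrite ?rpredN.
apply: (big_ind2 (fun (x : {mpoly R[k]}) d => x \is d.-homog)) => //.
- exact: dhomog1.
- by move=> x d y e; apply: dhomogM.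
Qed.

Lemma dhomog_resT i j : F \is i.-homog -> G \is j.-homog ->
  resT m n F G \is ((n * i + m * j)%N).-homog.
Proof.
move=> hF hG; pose w (l : 'I_(n + m)) := if split l is inl _ then i else j.
have -> : (n * i + m * j = \sum_i w i)%N.
  rewrite big_split_ord /= -[n in LHS]card_ord -[m in LHS]card_ord -!sum_nat_const.
  congr (_ + _)%N; apply: eq_bigr => l _; rewrite /w.
    by rewrite (unsplitK (inl _ l)).
  by rewrite (unsplitK (inr _ l)).
apply: dhomog_det => l c; rewrite /sylvesterT /w mxE.
by case: splitP => k _; rewrite !mxE; case: ifP => _;
  rewrite ?rpred0 ?dhomog_coefT.
Qed.

Definition monT_col N : 'cV[ringTX K]_N :=
  \col_j (monT K j (N.-1 - j))%:MP.

Hypotheses (hF : forall k, F@_k \is m.-homog) (hG : forall k, G@_k \is n.-homog).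

(** The rows of the Sylvester matrix are the coefficients of the multiples of
    [F] and [G] by monomials in [T]. *)
Lemma sylvester_mul_col :
  map_mx (@constT K) (sylvesterT m n F G) *m monT_col (n + m) =
  col_mx (\col_i ((monT K i (n.-1 - i))%:MP * F))
         (\col_i ((monT K i (m.-1 - i))%:MP * G)).
Proof.
have row c b N (H : ringTX K) i : (b + c)%N = N ->
    (forall k, H@_k \is c.-homog) -> (i < b)%N ->
    \sum_(j < N) constT (if (i <= j <= i + c)%N
        then coefT (j - i) (c - (j - i)) H else 0) *
      (monT K j (N.-1 - j))%:MP = (monT K i (b.-1 - i))%:MP * H.
  move=> <- hH ib; rewrite [in RHS](T_expansion hH) mulr_sumr.
  pose x j := constT (coefT (j - i) (c - (j - i)) H) *
      (monT K j ((b + c).-1 - j))%:MP.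
  rewrite (eq_bigr (fun j : 'I__ => if (i <= j <= i + c)%N then x j else 0)).
    rewrite sum_window ?ltn_add2r //; apply: eq_bigr => l _.
    rewrite /x addKn mulrCA -mpolyCM -monTD; congr (_ * (monT _ _ _)%:MP).
    have lc : (l <= c)%N by rewrite -ltnS.
    by lia.
  by move=> j _; case: ifP => // _; rewrite rmorph0 mul0r.
apply/colP => i; rewrite !mxE.
case: splitP => k ik; rewrite !mxE.
  rewrite -(row m n (n + m)%N F k erefl hF (ltn_ord k)).
  apply: eq_bigr => j _; rewrite !mxE.
  case: splitP => l il; last by have := ltn_ord k; lia.
  by rewrite mxE (_ : l = k) //; apply/val_inj/eqP; rewrite /= -il -ik.
rewrite -(row n m (n + m)%N G k (addnC m n) hG (ltn_ord k)).
apply: eq_bigr => j _; rewrite !mxE.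
case: splitP => l il; first by have := ltn_ord l; lia.
rewrite mxE (_ : l = k) //; apply/val_inj/eqP; rewrite /=.
by rewrite -(eqn_add2l n) -il -ik.
Qed.

End Sylvester.

Section Elimination.
Variable K : closedFieldType.

(** By the adjugate formula the resultant times a monomial in [T] lies in the
    ideal of [F] and [G]. *)
Lemma resT_eliminates m n (F G : ringTX K) (B : idomainType)
    (rho : {rmorphism ringTX K -> B}) :
  (forall k, F@_k \is m.-homog) -> (forall k, G@_k \is n.-homog) ->
  (0 < n + m)%N -> (forall a b, rho (monT K a b)%:MP != 0) ->
  rho F = 0 -> rho G = 0 -> rho (constT (resT m n F G)) = 0.
Proof.
move=> hF hG nm0 hrho F0 G0; set M := map_mx (@constT K) (sylvesterT m n F G).
pose i := Ordinal nm0.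
have /colP/(_ i) := congr1 (mulmx (\adj M)) (sylvester_mul_col hF hG).
rewrite mulmxA mul_adj_mx mul_scalar_mx det_map_mx -/(resT m n F G) !mxE.
move=> /(congr1 rho); rewrite rmorphM [RHS]rmorph_sum [RHS]big1 => [/eqP|k _]; last first.
  rewrite rmorphM /= [col_mx _ _ _ _]mxE.
  by case: splitP => l _; rewrite [X in _ * rho X]mxE [X in _ * X]rmorphM ?F0 ?G0 /= ?F0 ?G0 !mulr0.
by rewrite mulf_eq0 (negPf (hrho _ _)) orbF => /eqP.
Qed.

Lemma dhomog_moving_line_coef e (q0 q1 : ringT K) k :
  q0 \is e.-homog -> q1 \is e.-homog -> (moving_line q0 q1)@_k \is e.-homog.
Proof.
move=> h0 h1; rewrite /moving_line mcoeffB !mcoeffZ !mcoeffX.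
by rewrite rpredB //; case: eqP; rewrite ?mulr1 ?mulr0 ?rpred0.
Qed.

Lemma dhomog_moving_line (A : idomainType) (q0 q1 : A) :
  moving_line q0 q1 \is 1.-homog.
Proof. by rewrite rpredB // rpredZ // dhomogX /= mdeg1. Qed.

(** Vanishing of the resultant is a relation [x L + y G = 0] with [y] of lower
    degree in [T] than [L]. As [L] is prime and does not divide [G], it
    divides [y], which forces [y = 0]. *)
Lemma resT_moving_line_neq0 e n j (q0 q1 : ringT K) (G : ringTX K) :
  q0 \is e.-homog -> q1 \is e.-homog -> q1 != 0 -> no_common_zero q1 q0 ->
  bihomog n j G -> on_moving_line q0 q1 G != 0 ->
  resT e n (moving_line q0 q1) G != 0.
Proof.
move=> h0 h1 q1n cop [hGj hGn] Gn; set L := moving_line q0 q1.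
have hL k : L@_k \is e.-homog by apply: dhomog_moving_line_coef.
have Ln : L != 0.
  apply: contraNneq q1n => z; have := congr1 (mcoeff U_(0%R)) z.
  rewrite mcoeff0 /L /moving_line mcoeffB !mcoeffZ !mcoeffXU /=.
  by rewrite mulr1 mulr0 subr0 => ->.
apply/det0P => -[v vn vM].
(* The two blocks of [v], continued by 0. *)
pose x i := if insub i is Some k then v 0 (lshift e k) else 0 : ringX K.
pose y i := if insub i is Some k then v 0 (rshift n k) else 0 : ringX K.
pose X : ringTX K := \sum_(i < n) constT (x i) * (monT K i (n.-1 - i))%:MP.
pose Y : ringTX K := \sum_(i < e) constT (y i) * (monT K i (e.-1 - i))%:MP.
have xE (i : 'I_n) : x i = v 0 (lshift e i) by rewrite /x valK.
have yE (i : 'I_e) : y i = v 0 (rshift n i) by rewrite /y valK.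
have rel : X * L + Y * G = 0.
  have := congr1 (mulmx (map_mx (@constT K) v)) (sylvester_mul_col hL hGn).
  rewrite mulmxA -map_mxM vM map_mx0 mul0mx => /matrixP/(_ 0 0).
  rewrite !mxE big_split_ord /= => e0.
  apply: etrans (esym e0); rewrite /X /Y !mulr_suml; congr (_ + _).
    by apply: eq_bigr => i _; rewrite xE col_mxEu [(map_mx _ _) _ _]mxE
      [X in _ = _ * X]mxE [RHS]mulrA.
  by apply: eq_bigr => i _; rewrite yE col_mxEd [(map_mx _ _) _ _]mxE
    [X in _ = _ * X]mxE [RHS]mulrA.
have hY m : Y@_m \is e.-1.-homog.
  rewrite linear_sum /=; apply: rpred_sum => i _.
  rewrite mcoeff_constT_mul rpredZ //.
  have ie : (i + (e.-1 - i))%N = e.-1 by have := ltn_ord i; lia.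
  by have := dhomog_monT K i (e.-1 - i); rewrite ie.
have Y0 : Y = 0.
  have [e0|e0] := posnP e; first by rewrite /Y; clear -e0; subst e; rewrite big_ord0.
  have comp s : pihomog mdeg s Y = 0.
    (* The factor [X_2] makes the degree of [x L] positive for every [s], and it
       restricts to the variable, which is not a zero divisor. *)
    have hX2 : 'X_ord_max \is [in (ringT K)[3], 1.-homog].
      by rewrite dhomogX /= mdeg1.
    have /(congr1 (pihomog mdeg (s + 1 + j))) : 'X_ord_max * Y * G =
        - ('X_ord_max * X * L).
      by apply/eqP; rewrite -addr_eq0 -!mulrA -mulrDr addrC rel mulr0.
    rewrite pihomogM // ['X__ * Y]mulrC pihomogM // linearN /= addnAC.
    rewrite [X in - X]pihomogM ?dhomog_moving_line // => eqn.
    have [c ec] : multiple_of (pihomog mdeg s Y) L.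
      apply: (on_moving_line_eq0 q1n _ (pihomogP mdeg s Y)).
        move=> z; apply: (form_coprime_dvd h1 q1n cop).
      exact: on_moving_line_relation Gn eqn.
    (* The leading coefficient of [L], of degree [e], would divide that of this
       component, of degree [e - 1]. *)
    apply/eqP; case: eqP => // /eqP Yn.
    have hYs : mleadc (pihomog mdeg s Y) \is e.-1.-homog.
      rewrite /pihomog linear_sum /=; apply: rpred_sum => m _.
      by rewrite mcoeffZ mcoeffX; case: eqP; rewrite ?mulr1 ?mulr0 ?rpred0.
    suff z : mleadc (pihomog mdeg s Y) = 0 by move: Yn; rewrite -mleadc_eq0 z eqxx.
    apply: (form_dvd_eq0 (hL (mlead L)) hYs); first by rewrite mleadc_eq0.
      by rewrite prednK.
    have cn : c != 0 by apply: contraNneq Yn => z; rewrite ec z mul0r.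
    by exists (mleadc c); rewrite ec mleadM // mleadcM.
  by rewrite (pihomog_partitionE (leqnn (msize Y))) big1.
have X0 : X = 0.
  apply: (mulIf Ln); rewrite [RHS]mul0r.
  have drop (R : nzRingType) (a b c : R) : b = 0 -> a + b * c = 0 -> a = 0.
    by move=> ->; rewrite mul0r addr0.
  exact: drop Y0 rel.
case/eqP: vn; apply/rowP => i; rewrite mxE.
rewrite -(splitK i); case: (split i) => k /=.
  by rewrite -xE (coefT_inj X0).
by rewrite -yE (coefT_inj Y0).
Qed.

End Elimination.

(** * Moving lines that follow the curve *)

Lemma linear_expansion (A : nzRingType) (G : {mpoly A[3]}) : G \is 1.-homog ->
  G = G@_U_(0) *: 'X_0 + G@_U_(1) *: 'X_1 + G@_U_(ord_max) *: 'X_ord_max.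
Proof.
move=> hG; apply/mpolyP => m; rewrite !mcoeffD !mcoeffZ !mcoeffX.
have [/mdeg1P[i /eqP ->]|mn] := boolP (mdeg m == 1%N).
  rewrite !eq_mnm1.
  by case: (ord3_cases i) => ->; rewrite !(mulr1, mulr0, addr0, add0r).
rewrite (dhomog_nemf_coeff hG) //.
have z (i : 'I_3) : (U_(i)%MM == m) = false.
  by apply: contraNF mn => /eqP <-; rewrite mdeg1.
by rewrite !z !mulr0 !addr0.
Qed.

Section Bihomogeneous.
Variable K : closedFieldType.
Implicit Types G H : ringTX K.

Lemma bihomogD i j G H : bihomog i j G -> bihomog i j H -> bihomog i j (G + H).
Proof.
by move=> [G1 G2] [H1 H2]; split=> [|m]; rewrite ?mcoeffD rpredD.
Qed.

Lemma bihomogM i j i' j' G H : bihomog i j G -> bihomog i' j' H ->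
  bihomog (i + i') (j + j') (G * H).
Proof.
move=> [G1 G2] [H1 H2]; split=> [|m]; first exact: dhomogM.
by rewrite mcoeffM; apply: rpred_sum => k _; apply: dhomogM.
Qed.

Lemma bihomogX k : bihomog 0 1 ('X_k : ringTX K).
Proof.
split=> [|m]; first by rewrite dhomogX /= mdeg1.
by rewrite mcoeffX; case: eqP => _; rewrite ?rpred0 ?dhomog1.
Qed.

End Bihomogeneous.

Section Rees.
Variables (K : closedFieldType) (u : 'I_3 -> ringT K).

Lemma reesE G : reesK u G = (on_line u G = 0). Proof. by []. Qed.

Lemma reesK_moving_line q0 q1 :
  reesK u (moving_line q0 q1) <-> q1 * u 0 = q0 * u 1.
Proof.
rewrite reesE rmorphB /= !on_lineZ !on_lineX !scalerA -scalerBl -mul_polyC; split.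
  by move=> /eqP; rewrite mulf_eq0 polyX_eq0 orbF polyC_eq0 subr_eq0 => /eqP.
by move=> ->; rewrite subrr mul0r.
Qed.

End Rees.

Section Curve.
Variables (K : closedFieldType) (d mu : nat) (u : 'I_3 -> ringT K).
Variables (E : ringX K) (P Q : ringTX K).
Hypotheses (hu : parametrization u d) (hE : curve_equation u d E).
Hypotheses (hPQ : mu_basis u d mu P Q).
Hypotheses (mu_gt0 : (0 < mu)%N) (d_gt1 : (1 < d)%N).

Let hom_u i : u i \is d.-homog. Proof. by case: hu. Qed.

Lemma linear_form_nonunit t : linear_form t \isn't a @GRing.unit (ringT K).
Proof.
apply/negP => /(rmorph_unit (on_line t)) /=.
rewrite (on_line_form t (dhomog_linear_form t)) /linear_form mevalB !mevalZ.
by rewrite !mevalXU mulrC subrr scale0r unitr0.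
Qed.

Lemma param_no_base_point t : nonzero_vec t -> exists i, (u i).@[t] != 0.
Proof.
move=> tn; apply: Classical_Prop.NNPP => nz.
have [d0 _ hg] := hu; case/negP: (linear_form_nonunit t); apply: hg => i.
have := hom_u i; rewrite -(prednK d0) => hi.
have [|g _ ->] := form_dvd_linear tn hi; last by exists g.
by apply/eqP; apply: contraT => ui; case: nz; exists i.
Qed.

Lemma rees_constT_eq0 j (G : ringX K) :
  G \is j.-homog -> (j < d)%N -> reesK u (constT G) -> G = 0.
Proof.
case: hE => -[E0 _ _] hEd _ hEK hG jd /hEK.
exact: form_dvd_eq0 hEd hG E0 jd.
Qed.

Lemma param_neq0 i : u i != 0.
Proof.
apply/eqP => ui; suff: 'X_i = 0 :> ringX K.
  move=> /(congr1 (mcoeff U_(i))); rewrite mcoeffX eqxx mcoeff0 => /eqP.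
  by rewrite oner_eq0.
apply: (@rees_constT_eq0 1); rewrite ?dhomogX /= ?mdeg1 //.
by rewrite reesE /constT map_mpolyX on_lineX ui scale0r.
Qed.

(** If [g] divides [P], the quotient is again a syzygy; expanding it in the
    basis [P, Q] shows that [g] is invertible. *)
Lemma mu_basis_primitive g P' : P = g *: P' -> g \is a GRing.unit.
Proof.
move=> eP; have [_ [[hP _] hPr] [[hQ _] hQr] hB] := hPQ.
have Puniq a b : P = a *: P + b *: Q -> a = 1 /\ b = 0.
  move=> e; have [ab [_ U]] := hB P hP hPr.
  have e1 := U (a, b) e; have := U (1, 0).
  by rewrite /= scale1r scale0r addr0 e1 => /(_ erefl) [-> ->].
have g0 : g != 0.
  apply/eqP => z; have := @Puniq 0 0; rewrite !scale0r addr0 eP z scale0r.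
  by move=> /(_ erefl) [/esym/eqP]; rewrite oner_eq0.
have hP' : pihomog mdeg 1 P' \is 1.-homog by apply: pihomogP.
have eP1 : P = g *: pihomog mdeg 1 P' by rewrite -linearZ /= -eP pihomog_dE.
have hP'r : reesK u (pihomog mdeg 1 P').
  apply/eqP; move: hPr; rewrite eP1 reesE on_lineZ -mul_polyC => /eqP.
  by rewrite mulf_eq0 polyC_eq0 (negPf g0).
have [[a b] /= [e _]] := hB _ hP' hP'r.
have [ga _] : g * a = 1 /\ g * b = 0.
  by apply: Puniq; rewrite -!scalerA -scalerDr -e.
by apply/unitrP; exists a; rewrite mulrC ga.
Qed.

Lemma mu_basis_independent c : Q <> c *: P.
Proof.
move=> eQ; have [_ [[hP _] hPr] [[hQ _] hQr] hB] := hPQ.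
have [ab [_ U]] := hB Q hQ hQr.
have := U (0, 1); rewrite /= scale1r scale0r add0r => /(_ erefl).
have -> := U (c, 0); last by rewrite /= scale0r addr0.
by move=> /(congr1 snd) /= /esym/eqP; rewrite oner_eq0.
Qed.

Lemma multiple_of_form_linear (G : ringTX K) : G \is 1.-homog ->
  multiple_of G P -> exists c, G = c *: P.
Proof.
have [_ [[hP _] _] _ _] := hPQ.
move=> hG [c e]; exists ((pihomog mdeg 0 c)@_0).
rewrite -mul_mpolyC -form0P; last exact: pihomogP.
by rewrite -(pihomogM _ _ hP) -e pihomog_dE.
Qed.

Section SpecialMovingLine.
Hypothesis hP2 : P@_U_(ord_max) = 0.

Let p0 := p_0 P.
Let p1 := p_1 P.

Lemma mu_basis_moving_line : P = moving_line p0 p1.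
Proof.
have [_ [[hP _] _] _ _] := hPQ.
rewrite {1}(linear_expansion hP) hP2 scale0r addr0 /moving_line /p0 /p1.
by rewrite /p_0 /p_1 scaleNr opprK.
Qed.

Let hp0 : p0 \is mu.-homog.
Proof. by have [_ [[_ hP] _] _ _] := hPQ; rewrite /p0 /p_0 rpredN; apply: hP. Qed.

Let hp1 : p1 \is mu.-homog.
Proof. by have [_ [[_ hP] _] _ _] := hPQ; apply: hP. Qed.

Lemma p_no_common_zero : no_common_zero p1 p0.
Proof.
move=> t tn t1; apply/eqP => t0.
have [a [b [e0 e1]]] : exists a b, p0 = linear_form t * a /\ p1 = linear_form t * b.
  move: hp0 hp1; rewrite -(prednK mu_gt0) => h0 h1.
  have [a _ ->] := form_dvd_linear tn h0 t0.
  have [b _ ->] := form_dvd_linear tn h1 t1.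
  by exists a, b; rewrite ![_ * linear_form t]mulrC.
case/negP: (linear_form_nonunit t); apply: (@mu_basis_primitive _ (moving_line a b)).
by rewrite mu_basis_moving_line e0 e1 /moving_line scalerBr !scalerA.
Qed.

Let rel : p1 * u 0 = p0 * u 1.
Proof.
have [_ [_ hPr] _ _] := hPQ.
by apply/reesK_moving_line; rewrite -mu_basis_moving_line.
Qed.

Lemma p1_neq0 : p1 != 0.
Proof.
apply/eqP => z; move: rel; rewrite z mul0r => /esym/eqP.
rewrite mulf_eq0 (negPf (param_neq0 1)) orbF => /eqP z0.
have := mu_basis_primitive (g := 0) (P' := 0); rewrite unitr0 scale0r => h.
by suff: false by []; apply: h; rewrite mu_basis_moving_line z z0 /moving_line !scale0r subrr.
Qed.

Lemma p1_coprime x : multiple_of (p0 * x) p1 -> multiple_of x p1.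
Proof. exact: form_coprime_dvd hp1 p1_neq0 p_no_common_zero. Qed.

Lemma param_factor : exists h, u 0 = h * p0 /\ u 1 = h * p1.
Proof.
have [|h e1] := @p1_coprime (u 1); first by exists (u 0); rewrite -rel mulrC.
exists h; split=> //; apply: (mulfI p1_neq0).
by rewrite rel e1 mulrA mulrC [p0 * h]mulrC.
Qed.

Lemma on_mu_line_eq0 j G : G \is j.-homog ->
  on_moving_line p0 p1 G = 0 -> multiple_of G P.
Proof.
rewrite mu_basis_moving_line; apply: on_moving_line_eq0 p1_neq0 _ _ _.
exact: p1_coprime.
Qed.

Lemma on_mu_line_multiple G : multiple_of G P -> on_moving_line p0 p1 G = 0.
Proof.
by rewrite mu_basis_moving_line => -[c ->]; rewrite rmorphM /= on_moving_line_self mulr0.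
Qed.

(** If [g_b] are the coefficients of the restriction of [G] to the moving line
    [P], then [G] vanishes on the curve when [\sum_b g_b h^(j-b) u_2^b = 0].
    As [h] and [u_2] are coprime, [u_2], of degree [d], divides the first
    nonzero [g_b], of degree at most [i + mu j]. *)
Lemma low_degree_multiple i j G : bihomog i j G -> reesK u G ->
  (i + mu * j < d)%N -> multiple_of G P.
Proof.
move=> hG Gr lt; apply: (on_mu_line_eq0 hG.1).
have [h [e0 e1]] := param_factor; set g := on_moving_line p0 p1 G.
have sum0 : \sum_(b < j.+1) g`_b * h ^+ (j - b) * u ord_max ^+ b = 0.
  have := congr1 (horner_eval 1) Gr; rewrite /reesK.
  rewrite (@mmap_eq _ _ _ _ _ (coord3 (p0%:P * (h *: 'X)) (p1%:P * (h *: 'X))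
    (u ord_max *: 'X))); last first.
    move=> k; case: (ord3_cases k) => ->; rewrite /coord3 //= ?e0 ?e1.
      by rewrite -!mul_polyC mulrA -polyCM [p0 * h]mulrC.
    by rewrite -!mul_polyC mulrA -polyCM [p1 * h]mulrC.
  rewrite (mmap_on_moving_line (@polyC (ringT K)) _ _ _ _ hG.1) rmorph_sum rmorph0 /=.
  move=> e; rewrite -[RHS]e; apply: eq_bigr => b _.
  by rewrite /horner_eval !hornerE.
apply/eqP; apply: contraT => gn.
have ex : exists b, g`_b != 0.
  by exists (size g).-1; rewrite -lead_coefE lead_coef_eq0.
have [b gb bmin] := ex_minnP ex.
have bj : (b < j.+1)%N.
  by apply: contraNT gb; rewrite -leqNgt => jb; rewrite nth_default //;
    apply: leq_trans (size_on_moving_line _ _ hG.1) jb.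
have dvd : multiple_of (h ^+ (j - b) * g`_b) (u ord_max).
  move: sum0; rewrite (bigD1 (Ordinal bj)) //= => /eqP; rewrite addr_eq0 => /eqP s0.
  have [c ec] : multiple_of (g`_b * h ^+ (j - b) * u ord_max ^+ b) (u ord_max ^+ b.+1).
    rewrite s0; apply: multiple_ofN; rewrite big_mkcond /=.
    apply: multiple_of_sum => k _; case: eqP => [_|kb]; first exact: multiple_of0.
    have [lt_kb|le_bk] := ltnP k b.
      have /eqP -> : g`_k == 0 by apply: contraLR lt_kb => /bmin; rewrite -leqNgt.
      by rewrite !mul0r; apply: multiple_of0.
    have /subnK <- : (b.+1 <= k)%N.
      by rewrite ltn_neqAle le_bk andbT; apply/eqP => bk; apply: kb; apply/val_inj.
    by rewrite exprD mulrA; apply/multiple_ofMl/multiple_of_refl.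
  exists c; apply: (@mulIf _ (u ord_max ^+ b)); first by rewrite expf_neq0 ?param_neq0.
  by rewrite [h ^+ _ * _]mulrC ec exprS mulrA.
have gb0 : g`_b = 0.
  apply: (form_dvd_eq0 (hom_u ord_max) (dhomog_on_moving_line hp0 hp1 b hG)).
  - exact: param_neq0.
  - by apply: leq_ltn_trans lt; rewrite leq_add2l leq_mul2l leq_subr orbT.
  apply: form_coprime_dvd (hom_u _) (param_neq0 _) _ dvd => t tn t2.
  rewrite rmorphXn expf_neq0 //; apply/eqP => h0.
  have [k] := param_no_base_point tn; case: (ord3_cases k) => ->.
  - by rewrite e0 mevalM h0 mul0r eqxx.
  - by rewrite e1 mevalM h0 mul0r eqxx.
  - by rewrite t2 eqxx.
by rewrite gb0 eqxx in gb.
Qed.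

(** On the moving line [X_0 = p_0] and [X_1 = p_1]. *)
Lemma on_mu_line_DT i j G H : DT mu P i j G H ->
  on_moving_line p0 p1 H = on_moving_line p0 p1 G.
Proof.
move=> [_ _ [G0 [G1 [_ _ -> ->]]]].
rewrite !rmorphD !rmorphM /= !on_moving_lineZ !on_moving_lineX /coord3 /=.
by rewrite !mul_polyC.
Qed.

Lemma reesK_DT i j G H : DT mu P i j G H -> reesK u G -> reesK u H.
Proof.
move=> [_ _ [G0 [G1 [_ _ -> ->]]]]; have [h [e0 e1]] := param_factor.
rewrite !reesE !rmorphD !rmorphM /= !on_lineZ !on_lineX e0 e1 => Gr.
transitivity (h%:P * 'X * (p0 *: on_line u G0 + p1 *: on_line u G1)); last first.
  by rewrite Gr mulr0.
move: (on_line u G0) (on_line u G1) => a b; rewrite -!mul_polyC !polyCM mulrDr.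
congr (_ + _).
  by rewrite -[LHS]mulrA -[LHS]mulrA -[RHS]mulrA [p0%:P * ('X * _)]mulrCA.
by rewrite -[LHS]mulrA -[LHS]mulrA -[RHS]mulrA [p1%:P * ('X * _)]mulrCA.
Qed.

Lemma bihomog_DT i j G H : DT mu P i j G H -> bihomog (i - mu) j.+1 H.
Proof.
move=> [_ _ [G0 [G1 [h0 h1 _ ->]]]]; rewrite -add1n -[(i - mu)%N]add0n.
by apply: bihomogD; apply: bihomogM => //; apply: bihomogX.
Qed.

End SpecialMovingLine.
End Curve.

(** * The moving line of least degree passes through the singular point *)

Section Chart.
Variable K : closedFieldType.
Implicit Types (E g : ringX K).

Lemma order_at0_lt n (f : {mpoly K[n]}) k :
  (k < order_at0 f)%N -> forall m, m \in msupp f -> (k < mdeg m)%N.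
Proof.
move=> lt m mf; apply: leq_trans lt _; rewrite /order_at0.
elim: (msupp f) mf => // m' s IH; rewrite inE big_cons => /predU1P[->|/IH].
  exact: geq_minl.
exact/leq_trans/geq_minr.
Qed.

(** Dehomogenizing by [X_2 = 1] does not merge monomials of a form. *)
Lemma very_singular_msupp d mu E : E \is d.-homog ->
  very_singular mu E (point001 K) ->
  forall m, m \in msupp E -> (mu < m 0%R + m 1%R)%N.
Proof.
move=> hEd [_ [i [+ lt]]] m mE; rewrite /point001.
have [ei _|] := eqVneq i ord_max; last by rewrite eqxx.
move: lt; rewrite {i}ei => lt.
pose loc : ringX K := mmap (@mpolyC 3 K) (coord3 'X_0 'X_1 1) E.
have locE : local_equation E (point001 K) ord_max = loc.
  apply: mmap_eq => k; rewrite tnth_mktuple /point001.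
  by case: (ord3_cases k) => ->; rewrite /coord3 /= ?add0r ?addr0 ?mpolyC0 ?add0r.
pose m' : 'X_{1..3} := [multinom if k == ord_max then 0%N else m k | k < 3].
have loc_m' : loc@_m' = E@_m.
  rewrite /loc /mmap linear_sum /= (bigD1_seq m) ?msupp_uniq //=.
  have cE k : (k \in msupp E) ->
      ((E@_k)%:MP * mmap1 (coord3 'X_0 'X_1 1) k)@_m' = E@_k * (k == m)%:R.
    move=> kE; rewrite mcoeffCM mmap1_coord3 expr1n mulr1 !mpolyXn -mpolyXD mcoeffX.
    congr (_ * _%:R); congr nat_of_bool; apply/eqP/eqP => [e|->]; last first.
      apply/mnmP => l; rewrite mnmDE !mulmnE !mnm1E mnmE.
      by case: (ord3_cases l) => -> /=; rewrite ?muln0 ?addn0 ?mul1n ?mul0n.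
    have e0 := congr1 (fun m : 'X_{1..3} => m 0%R) e.
    have e1 := congr1 (fun m : 'X_{1..3} => m 1%R) e.
    move: e0 e1; rewrite /= !mnmDE !mulmnE !mnm1E !mnmE /= !mul0n !mul1n addn0 add0n => e0 e1.
    apply/mnmP => l; case: (ord3_cases l) => -> //.
    have := dhomog_mf hEd kE; have := dhomog_mf hEd mE; rewrite /= !mdeg3 e0 e1.
    by move=> <- /addnI.
  rewrite cE // eqxx mulr1 big1_seq ?addr0 // => k /andP[/negPf km kE].
  by rewrite cE // km mulr0.
have m'loc : m' \in msupp loc by rewrite mcoeff_msupp loc_m' -mcoeff_msupp.
have := order_at0_lt lt; rewrite locE => /(_ _ m'loc).
by rewrite mdeg3 !mnmE /= addn0.
Qed.

(** [X_0] and [X_1] are multiplied by a new variable, in which the order is the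
    order of vanishing at (0:0:1). *)
Definition at_point : ringX K -> {poly ringX K} :=
  mmap (@polyC (ringX K) \o @mpolyC 3 K)
    (coord3 ('X_0 *: 'X) ('X_1 *: 'X) ('X_ord_max)%:P).

HB.instance Definition _ := GRing.RMorphism.on at_point.

Lemma at_point_mult mu E :
  (forall m, m \in msupp E -> (mu < m 0%R + m 1%R)%N) ->
  exists R, at_point E = 'X^(mu.+1) * R.
Proof.
move=> hE; suff [R ->] : multiple_of (at_point E) 'X^(mu.+1).
  by exists R; rewrite mulrC.
apply: multiple_of_sum => m mE; apply: multiple_ofMl.
rewrite mmap1_coord3; apply: multiple_ofMr.
rewrite !exprZn -!mul_polyC mulrACA -exprD.
apply: multiple_ofMl; rewrite -(subnK (hE m mE)) exprD.
by apply: multiple_ofMl; apply: multiple_of_refl.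
Qed.

Lemma at_point_linear g : g \is 1.-homog ->
  at_point g = 'X * (g - g@_U_(ord_max) *: 'X_ord_max)%:P
               + (g@_U_(ord_max) *: 'X_ord_max)%:P.
Proof.
move=> hg; rewrite {2}(linear_expansion hg) addrK {1}(linear_expansion hg).
have mon (x : K) (y : ringX K) : x%:MP%:P * (y *: 'X) = 'X * (x *: y)%:P.
  by rewrite -mul_mpolyC polyCM -mul_polyC mulrA mulrC.
have pt0 x : at_point (x *: 'X_0) = 'X * (x *: 'X_0)%:P.
  by rewrite /at_point mmapZ mmapX mmap1U; apply: mon.
have pt1 x : at_point (x *: 'X_1) = 'X * (x *: 'X_1)%:P.
  by rewrite /at_point mmapZ mmapX mmap1U; apply: mon.
have pt2 x : at_point (x *: 'X_ord_max) = (x *: 'X_ord_max)%:P.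
  by rewrite /at_point mmapZ mmapX mmap1U /coord3 /= -polyCM mul_mpolyC.
have ptD x y : at_point (x + y) = at_point x + at_point y by apply: rmorphD.
by rewrite !ptD pt0 pt1 pt2 polyCD mulrDr.
Qed.

End Chart.

Section SpecialLine.
Variables (K : closedFieldType) (d mu : nat) (u : 'I_3 -> ringT K).
Variables (E : ringX K) (P Q : ringTX K).
Hypotheses (hu : parametrization u d) (hE : curve_equation u d E).
Hypotheses (hPQ : mu_basis u d mu P Q).
Hypotheses (mu_gt0 : (0 < mu)%N) (d_gt1 : (1 < d)%N).

Lemma on_line_monT_neq0 a b : on_line u (monT K a b)%:MP != 0.
Proof. by rewrite on_lineC polyC_eq0 monT_neq0. Qed.

Lemma coefT_linear a b (G : ringTX K) (c : ringT K) k :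
  coefT a b (c *: 'X_k) = c@_(mon2 a b) *: 'X_k.
Proof.
apply/mpolyP => m; rewrite mcoeff_coefT !mcoeffZ !mcoeffX.
by case: eqP => _; rewrite ?mulr1 ?mulr0 ?mcoeff0.
Qed.

(** Let [L] be the moving line that joins (0:0:1) to the points of the curve.
    [Res(L, P)] vanishes on the curve, so it is a multiple of [E] and has order
    more than [mu] at (0:0:1).  Only the [mu] rows of [L] in the Sylvester
    matrix vanish at that point, and the order is exactly [mu] unless the
    resultant of [L] with the coefficient of [X_2] in [P] is zero, that is,
    unless this coefficient is zero. *)
Lemma very_singular_mu_basis :
  very_singular mu E (point001 K) -> P@_U_(ord_max) = 0.
Proof.
move=> hsing; apply/eqP; apply: contraT => c0; set c := P@_U_(ord_max) in c0.
have [_ [[hP hPmu] hPr] _ _] := hPQ.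
have [_ hud _] := hu.
have un i := param_neq0 hE d_gt1 i.
have [e [h [q1 [q0 [hq1 hq0 e1 e0 cop]]]]] := form_gcd (hud 1) (hud 0) (un 1).
have q1n : q1 != 0 by apply: contraNneq (un 1) => z; rewrite e1 z mulr0.
set L := moving_line q0 q1.
have hL : L \is 1.-homog by apply: dhomog_moving_line.
have hLe k : L@_k \is e.-homog by apply: dhomog_moving_line_coef.
have Lr : reesK u L.
  by apply/reesK_moving_line; rewrite e0 e1 mulrCA [RHS]mulrCA [q0 * _]mulrC.
have [R eR] : multiple_of (resT e mu L P) E.
  case: hE => _ _ _ hEK; apply/hEK.
  have mue : (0 < mu + e)%N by rewrite addn_gt0 mu_gt0.
  by rewrite reesE; apply: (resT_eliminates hLe hPmu mue on_line_monT_neq0 Lr hPr).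
have [R' eR'] : exists R', at_point E = 'X^(mu.+1) * R'.
  apply: at_point_mult => m; case: hE => _ hEd _ _.
  exact: very_singular_msupp hEd hsing m.
pose top : 'M[{poly ringX K}]_(mu, mu + e) :=
  map_mx polyC (usubmx (sylvesterT e mu L P)).
pose bot : 'M[{poly ringX K}]_(e, mu + e) :=
  map_mx (@at_point K) (dsubmx (sylvesterT e mu L P)).
(* The rows of [L] are divisible by the new variable. *)
have scaled : map_mx (@at_point K) (sylvesterT e mu L P) = col_mx ('X *: top) bot.
  rewrite -[in LHS](vsubmxK (sylvesterT e mu L P)) map_col_mx; congr col_mx.
  apply/matrixP => i j; rewrite [RHS]mxE [in RHS]mxE [LHS]mxE.
  rewrite /sylvesterT col_mxKu mxE; case: ifP => _; last first.
    by rewrite rmorph0 mulr0.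
  rewrite at_point_linear ?dhomog_coefT //.
  suff -> : (coefT (j - i) (e - (j - i)) L)@_U_(ord_max) = 0.
    by rewrite scale0r polyC0 addr0 subr0.
  rewrite mcoeff_coefT /L /moving_line mcoeffB !mcoeffZ !mcoeffX !eq_mnm1 /=.
  by rewrite !mulr0 subrr mcoeff0.
have det_scaled : at_point (resT e mu L P) = 'X^mu * \det (col_mx top bot).
  rewrite /resT -det_map_mx scaled.
  have -> : col_mx ('X *: top) bot = block_mx 'X%:M 0 0 1%:M *m col_mx top bot.
    by rewrite mul_block_col !mul_scalar_mx scale1r !mul0mx addr0 add0r.
  by rewrite det_mulmx det_ublock det_scalar det1 mulr1.
have : (\det (col_mx top bot)).[0] = 0.
  have -> : \det (col_mx top bot) = 'X * (at_point R * R').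
    apply: (mulfI (x := 'X^mu)); first by rewrite expf_neq0 ?polyX_eq0.
    rewrite -det_scaled eR rmorphM /= eR' exprSr.
    by rewrite [LHS]mulrCA -[LHS]mulrA.
  by rewrite hornerM hornerX mul0r.
have Rn : resT e mu L (c *: 'X_ord_max) != 0.
  apply: (resT_moving_line_neq0 (j := 1)) => //.
  - split=> [|m]; first by rewrite rpredZ // dhomogX /= mdeg1.
    rewrite mcoeffZ mcoeffX; case: eqP => _; rewrite ?mulr0 ?rpred0 // mulr1.
    exact: hPmu.
  - rewrite on_moving_lineZ on_moving_lineX /coord3 /=.
    by rewrite -mul_polyC mulf_eq0 polyC_eq0 (negPf c0) polyX_eq0.
suff -> : (\det (col_mx top bot)).[0] = resT e mu L (c *: 'X_ord_max).
  by move=> z; have := Rn; rewrite z eqxx.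
rewrite -[LHS]/(horner_eval 0 (\det _)) -det_map_mx /resT; congr (\det _).
rewrite map_col_mx /sylvesterT; congr col_mx; apply/matrixP => i j.
  rewrite [LHS]mxE /top [in LHS]mxE /= /horner_eval hornerC.
  by rewrite /sylvesterT col_mxKu.
rewrite [LHS]mxE /bot [in LHS]mxE /sylvesterT col_mxKd [RHS]mxE [in LHS]mxE.
rewrite /= /horner_eval; case: ifP => _; last first.
  by rewrite -[at_point 0]/(GRing.RMorphism.sort _ 0) rmorph0 horner0.
rewrite at_point_linear ?dhomog_coefT // hornerD hornerM hornerX.
rewrite mul0r add0r hornerC coefT_linear //.
by rewrite mcoeff_coefT.
Qed.

End SpecialLine.

(** * Finite generation of ideals *)

Section Ideals.
Variable A : idomainType.
Implicit Types (I : A -> Prop) (S T : seq A) (a b c : A).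

Definition is_ideal I :=
  [/\ I 0, forall a b, I a -> I b -> I (a + b) & forall c a, I a -> I (c * a)].

Lemma ideal_sub I a b : is_ideal I -> I a -> I b -> I (a - b).
Proof. by move=> [_ ID IM] Ia Ib; apply: ID => //; rewrite -mulN1r; apply: IM. Qed.

Lemma multiple_of_ideal b : is_ideal (fun a => multiple_of a b).
Proof.
split=> [|x y|c x]; first exact: multiple_of0.
  exact: multiple_ofD.
exact: multiple_ofMl.
Qed.

Lemma ideal_gen_ideal S : is_ideal (ideal_gen S).
Proof.
split.
- by exists (fun=> 0); rewrite big1 // => i _; rewrite mul0r.
- move=> a b [x ->] [y ->]; exists (fun i => x i + y i).
  by rewrite -big_split; apply: eq_bigr => i _; rewrite mulrDl.
- move=> c a [x ->]; exists (fun i => c * x i).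
  by rewrite mulr_sumr; apply: eq_bigr => i _; rewrite mulrA.
Qed.

Lemma ideal_gen_min I S a :
  is_ideal I -> (forall g, g \in S -> I g) -> ideal_gen S a -> I a.
Proof.
move=> [I0 ID IM] IS [c ->]; apply: (big_ind I) => // i _.
exact/IM/IS/mem_nth.
Qed.

Lemma ideal_gen_mem S a : a \in S -> ideal_gen S a.
Proof.
move=> aS; exists (fun i => (i == index a S)%:R).
have lt : (index a S < size S)%N by rewrite index_mem.
rewrite (bigD1 (Ordinal lt)) //= eqxx mul1r nth_index // big1 ?addr0 // => i.
by rewrite -val_eqE /= => /negPf ->; rewrite mul0r.
Qed.

Lemma ideal_gen_trans S T a :
  (forall g, g \in S -> ideal_gen T g) -> ideal_gen S a -> ideal_gen T a.
Proof. by move=> ST; apply: ideal_gen_min ST; apply: ideal_gen_ideal. Qed.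

Lemma ideal_gen_sub S T a : {subset S <= T} -> ideal_gen S a -> ideal_gen T a.
Proof. by move=> st; apply: ideal_gen_trans => g /st; apply: ideal_gen_mem. Qed.

Lemma ideal_gen_cons g S a :
  ideal_gen (g :: S) a -> exists c b, a = c * g + b /\ ideal_gen S b.
Proof.
move=> [c ->]; exists (c 0%N), (\sum_(i < size S) c i.+1 * S`_i).
by rewrite big_ord_recl; split=> //; exists (c \o succn).
Qed.

Definition noetherian := forall I, is_ideal I ->
  exists2 S, (forall g, g \in S -> I g) & forall a, I a -> ideal_gen S a.

End Ideals.

Lemma noetherian_field (F : fieldType) : noetherian F.
Proof.
move=> I [I0 _ _].
have [[a [Ia an]]|z] := Classical_Prop.classic (exists a, I a /\ a != 0).
  exists [:: a] => [g|b _]; first by rewrite inE => /eqP ->.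
  have [_ _ genM] := ideal_gen_ideal [:: a].
  by rewrite -(divfK an b); apply/genM/ideal_gen_mem; rewrite inE.
exists [::] => // a Ia; have [gen0 _ _] := ideal_gen_ideal (Nil F).
suff -> : a = 0 by [].
by apply/eqP; apply: contraT => an; case: z; exists a.
Qed.

Lemma noetherian_image (A B : idomainType) (f : {rmorphism A -> B}) :
  (forall b, exists a, f a = b) -> noetherian A -> noetherian B.
Proof.
move=> fsurj nA I [I0 ID IM].
have [|S IS gS] := nA (I \o f).
  split=> [|a b|c a] /=; rewrite ?rmorph0 ?rmorphD ?rmorphM //.
    exact: ID.
  exact: IM.
exists (map f S) => [g /mapP[a aS ->]|b]; first exact: IS.
have [a <-] := fsurj b => Ia.
have [gen0 genD genM] := ideal_gen_ideal (map f S).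
apply: (@ideal_gen_min _ (ideal_gen (map f S) \o f) S); last exact: gS.
  split=> [|x y|c x] /=; rewrite ?rmorph0 ?rmorphD ?rmorphM //.
    exact: genD.
  exact: genM.
by move=> g gS'; apply/ideal_gen_mem/map_f.
Qed.

(** Hilbert's basis theorem.  The coefficients of degree [n] of the elements
    of degree at most [n] of an ideal form an ideal [L n]; these ideals grow
    with [n] and their union is finitely generated, hence equal to one of
    them. *)
Section HilbertBasis.
Variable A : idomainType.
Hypothesis nA : noetherian A.
Variable I : {poly A} -> Prop.
Hypothesis idI : is_ideal I.

Let L n a := exists p, [/\ I p, (size p <= n.+1)%N & p`_n = a].

Let L_ideal n : is_ideal (L n).
Proof.
have [I0 ID IM] := idI; split.
- by exists 0; rewrite size_poly0 coef0.
- move=> a b [p [Ip sp <-]] [q [Iq sq <-]]; exists (p + q); rewrite coefD.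
  split=> //; first exact: ID.
  by rewrite (leq_trans (size_polyD _ _)) // geq_max sp.
- move=> c a [p [Ip sp <-]]; exists (c%:P * p); rewrite coefCM.
  split=> //; first exact: IM.
  by rewrite mul_polyC (leq_trans (size_scale_leq _ _)).
Qed.

Let L_mono m n a : (m <= n)%N -> L m a -> L n a.
Proof.
have [_ _ IM] := idI; move=> mn [p [Ip sp <-]]; exists ('X^(n - m) * p); split.
- exact: IM.
- rewrite (leq_trans (size_polyMleq _ _)) // size_polyXn /= -{2}(subnK mn) -addnS.
  by rewrite leq_add2l.
- by rewrite coefXnM ltnNge leq_subr /= subKn.
Qed.

Let L_stable : exists N, forall n a, L n a -> L N a.
Proof.
have [|S LS gS] := nA (I := fun a => exists n, L n a).
  split.
  - by exists 0%N; case: (L_ideal 0).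
  - move=> a b [m La] [n Lb]; exists (maxn m n).
    have [_ LD _] := L_ideal (maxn m n).
    by apply: LD; [apply: L_mono La | apply: L_mono Lb];
      rewrite ?leq_maxl ?leq_maxr.
  - by move=> c a [n La]; exists n; have [_ _ LM] := L_ideal n; apply: LM.
have [N LN] : exists N, forall g, g \in S -> L N g.
  elim: S LS {gS} => [|g S IH] LS; first by exists 0%N.
  have [|N LN] := IH; first by move=> x xS; apply: LS; rewrite inE xS orbT.
  have [|n Lg] := LS g; first by rewrite inE eqxx.
  exists (maxn n N) => x; rewrite inE => /predU1P[->|xS].
    by apply: L_mono Lg; rewrite leq_maxl.
  by apply: L_mono (LN _ xS); rewrite leq_maxr.
exists N => n a La; apply: (ideal_gen_min (L_ideal N) LN).
by apply: gS; exists n.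
Qed.

Let reaches (T : seq {poly A}) n := forall a, L n a ->
  exists p, [/\ ideal_gen T p, (size p <= n.+1)%N & p`_n = a].

Let reaches_degree n :
  exists2 T, (forall p, p \in T -> I p) & reaches T n.
Proof.
have [S LS gS] := nA (L_ideal n).
suff [T IT gT] : exists2 T, (forall p, p \in T -> I p) & forall a, ideal_gen S a ->
    exists p, [/\ ideal_gen T p, (size p <= n.+1)%N & p`_n = a].
  by exists T => // a /gS/gT.
elim: S LS {gS} => [|g S IH] LS.
  exists [::] => // a [c ->]; exists 0; rewrite big_ord0 size_poly0 coef0.
  by split=> //; case: (ideal_gen_ideal (Nil {poly A})).
have [|T IT gT] := IH; first by move=> x xS; apply: LS; rewrite inE xS orbT.
have [|q [Iq sq <-]] := LS g; first by rewrite inE eqxx.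
exists (q :: T) => [p|a /ideal_gen_cons[c [b [-> /gT[p [Tp sp <-]]]]]].
  by rewrite inE => /predU1P[->|/IT].
have [_ genD genM] := ideal_gen_ideal (q :: T).
exists (c%:P * q + p); rewrite coefD coefCM; split=> //.
  apply: genD; first by apply/genM/ideal_gen_mem; rewrite inE eqxx.
  by apply: ideal_gen_sub Tp => x xT; rewrite inE xT orbT.
rewrite (leq_trans (size_polyD _ _)) // geq_max sp andbT mul_polyC.
by rewrite (leq_trans (size_scale_leq _ _)).
Qed.

Lemma hilbert_basis_poly :
  exists2 S, (forall p, p \in S -> I p) & forall p, I p -> ideal_gen S p.
Proof.
have [N LN] := L_stable.
have [T IT rT] : exists2 T, (forall p, p \in T -> I p) &
    forall n, (n <= N)%N -> reaches T n.
  elim: N {LN} => [|N [T IT rT]].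
    have [T IT rT] := reaches_degree 0; exists T => // n.
    by rewrite leqn0 => /eqP ->.
  have [T' IT' rT'] := reaches_degree N.+1; exists (T ++ T') => [p|n nN a La].
    by rewrite mem_cat => /orP[/IT|/IT'].
  have [p [gp sp pn]] : exists p,
      [/\ ideal_gen (T ++ T') p, (size p <= n.+1)%N & p`_n = a].
    move: nN; rewrite leq_eqVlt => /predU1P[nN|nN].
      have [p [gp sp pn]] : exists p,
        [/\ ideal_gen T' p, (size p <= n.+1)%N & p`_n = a].
        by rewrite nN; apply: rT'; rewrite -nN.
      by exists p; split=> //; apply: ideal_gen_sub gp => x xT; rewrite mem_cat xT orbT.
    have [p [gp sp pn]] := rT n nN a La.
    by exists p; split=> //; apply: ideal_gen_sub gp => x xT; rewrite mem_cat xT.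
  by exists p.
have [_ _ genM] := ideal_gen_ideal T.
exists T => // p; have [n] := ubnP (size p); elim: n p => // n IH p sp Ip.
have [->|pn] := eqVneq p 0; first by case: (ideal_gen_ideal T).
have sp1 : (size p).-1.+1 = size p by rewrite prednK // lt0n size_poly_eq0.
have [q [gq sq qn]] : exists q,
    [/\ ideal_gen T q, (size q <= size p)%N & q`_(size p).-1 = p`_(size p).-1].
  have Lp : L (size p).-1 p`_(size p).-1 by exists p; rewrite sp1.
  have [le|/ltnW le] := leqP (size p).-1 N.
    by have [q [gq sq qn]] := rT _ le _ Lp; exists q; rewrite -sp1.
  have [q [gq sq qn]] := rT _ (leqnn N) _ (LN _ _ Lp).
  exists ('X^((size p).-1 - N) * q); split; first exact: genM.
    rewrite (leq_trans (size_polyMleq _ _)) // size_polyXn /= -[X in (_ <= X)%N]sp1.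
    by rewrite -{2}(subnK le) -addnS leq_add2l.
  by rewrite coefXnM ltnNge leq_subr /= subKn.
have -> : p = (p - q) + q by rewrite subrK.
have [_ genD _] := ideal_gen_ideal T; apply: genD => //; apply: IH.
  rewrite -ltnS (leq_ltn_trans _ sp) // -sp1 ltnS; apply/leq_sizeP => j.
  rewrite leq_eqVlt coefB => /predU1P[<-|jp]; first by rewrite qn subrr.
  by rewrite !nth_default ?subrr // ?(leq_trans sq) // -sp1.
by apply: ideal_sub => //; apply: ideal_gen_min gq.
Qed.

End HilbertBasis.

Lemma noetherian_poly (A : idomainType) : noetherian A -> noetherian {poly A}.
Proof. by move=> nA I idI; apply: hilbert_basis_poly. Qed.

Lemma noetherian_mpoly (A : idomainType) n :
  noetherian A -> noetherian {mpoly A[n]}.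
Proof.
move=> nA; elim: n => [|n /noetherian_poly].
  apply: (noetherian_image (f := @mpolyC 0 A)) => // p.
  by exists p@_0; apply/esym/nvar0_mpolyC.
pose f : {rmorphism {poly {mpoly A[n]}} -> {mpoly A[n.+1]}} :=
  horner_eval 'X_ord_max \o map_poly (@mwiden n A).
apply: (noetherian_image (f := f)) => p.
have fC (x : {mpoly A[n]}) : f x%:P = mwiden x.
  by rewrite /f /= /horner_eval map_polyC hornerC.
have fX i : exists x, f x = 'X_i.
  have [lt|ge] := ltnP i n.
    exists ('X_(Ordinal lt))%:P; rewrite fC mwidenX mnmwiden1.
    by congr 'X_[ U_(_) ]; apply/val_inj.
  exists 'X; rewrite /f /= /horner_eval map_polyX hornerX.
  congr 'X_[ U_(_) ]; apply/val_inj => /=.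
  by apply/eqP; rewrite eqn_leq ge -ltnS ltn_ord.
elim/mpolyind: p => [|c m p _ _ [x fx]]; first by exists 0; rewrite rmorph0.
suff [y fy] : exists y, f y = 'X_[m].
  by exists (c%:MP%:P * y + x); rewrite rmorphD rmorphM fC fx fy mwidenC mul_mpolyC.
rewrite mpolyXE_id; apply: (big_ind (fun q => exists y, f y = q)).
- by exists 1; rewrite rmorph1.
- by move=> _ _ [y <-] [z <-]; exists (y * z); rewrite rmorphM.
- by move=> i _; have [y <-] := fX i; exists (y ^+ m i); rewrite rmorphXn.
Qed.

(** * Minimal systems of bihomogeneous generators *)

Section Components.
Variable K : closedFieldType.
Implicit Types (G H : ringTX K).

Definition bicomp i j G : ringTX K :=
  map_mpoly (pihomog mdeg i) (pihomog mdeg j G).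

Lemma mcoeff_pihomog n (R : nzRingType) j (p : {mpoly R[n]}) m :
  (pihomog mdeg j p)@_m = if mdeg m == j then p@_m else 0.
Proof.
case: eqP => [mj|/eqP mj]; last exact: dhomog_nemf_coeff (pihomogP mdeg j p) mj.
rewrite pihomogE linear_sum /= -big_filter.
have [mp|mp] := boolP (m \in msupp p); last first.
  rewrite (memN_msupp_eq0 mp) big_filter big1_seq // => k /andP[_ kp].
  by rewrite mcoeffZ mcoeffX; case: eqP kp mp => [->->|]; rewrite ?mulr0.
rewrite (bigD1_seq m) ?filter_uniq ?msupp_uniq ?mem_filter ?mj ?eqxx //=.
rewrite mcoeffZ mcoeffX eqxx mulr1 big1 ?addr0 // => k /negPf km.
by rewrite mcoeffZ mcoeffX km mulr0.
Qed.

Lemma mcoeff_bicomp i j G m :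
  (bicomp i j G)@_m = if mdeg m == j then pihomog mdeg i G@_m else 0.
Proof.
rewrite /bicomp mcoeff_map_mpoly mcoeff_pihomog; case: ifP => // _.
exact: pihomog0.
Qed.

Lemma bicompD i j G H : bicomp i j (G + H) = bicomp i j G + bicomp i j H.
Proof. by rewrite /bicomp !raddfD. Qed.

Lemma bihomog_bicomp i j G : bihomog i j (bicomp i j G).
Proof.
split=> [|m]; last by rewrite mcoeff_bicomp; case: ifP; rewrite ?pihomogP ?rpred0.
apply/dhomogP => m; rewrite mcoeff_msupp mcoeff_bicomp.
by case: ifP => [/eqP //|_]; rewrite eqxx.
Qed.

Lemma bicomp_id i j G : bihomog i j G -> bicomp i j G = G.
Proof.
move=> [hG hGi]; apply/mpolyP => m; rewrite mcoeff_bicomp.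
case: eqP => [_|/eqP mj]; first by rewrite pihomog_dE.
by rewrite (dhomog_nemf_coeff hG).
Qed.

Lemma bihomog_uniq i j i' j' G : G != 0 ->
  bihomog i j G -> bihomog i' j' G -> i = i' /\ j = j'.
Proof.
move=> Gn [h1 h2] [h1' h2']; split; last exact: dhomog_uniq h1 h1'.
by apply: (dhomog_uniq _ (h2 (mlead G)) (h2' _)); rewrite mleadc_eq0.
Qed.

Lemma pihomogM_lt n (R : nzRingType) i j (f g : {mpoly R[n]}) :
  g \is j.-homog -> (i < j)%N -> pihomog mdeg i (f * g) = 0.
Proof.
move=> hg ij; rewrite [f](pihomog_partitionE (leqnn (msize f))) mulr_suml.
rewrite linear_sum big1 //= => k _.
rewrite (pihomog_ne0 _ (dhomogM (pihomogP mdeg k f) hg)) // gtn_eqF //.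
by rewrite (leq_trans ij) // leq_addl.
Qed.

Lemma bicompM i j i' j' G H : bihomog i' j' H -> (i' <= i)%N -> (j' <= j)%N ->
  bicomp i j (G * H) = bicomp (i - i') (j - j') G * H.
Proof.
move=> [hH hHi] ii jj; rewrite /bicomp -{1}(subnK jj) pihomogM //.
apply/mpolyP => m; rewrite mcoeff_map_mpoly /= !mcoeffM linear_sum /=.
apply: eq_bigr => k _.
by rewrite -{1}(subnK ii) pihomogM // mcoeff_map_mpoly.
Qed.

Lemma bicompM_eq0 i j i' j' G H : bihomog i' j' H ->
  ~~ ((i' <= i)%N && (j' <= j)%N) -> bicomp i j (G * H) = 0.
Proof.
move=> [hH hHi]; rewrite negb_and -!ltnNge => /orP[ii|jj]; last first.
  by rewrite /bicomp (pihomogM_lt _ hH) // raddf0.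
apply/mpolyP => m; rewrite mcoeff_bicomp mcoeff0; case: ifP => // _.
rewrite mcoeffM linear_sum big1 //= => k _.
exact: pihomogM_lt.
Qed.

Lemma bicomp_sum G : exists N,
  G = \sum_(i < N) \sum_(j < N) bicomp i j G.
Proof.
pose N := maxn (msize G) (\max_(m <- msupp G) msize G@_m).
exists N; rewrite exchange_big /=.
rewrite [LHS](pihomog_partitionE (leq_maxl _ _ : (msize G <= N)%N)).
apply: eq_bigr => j _; apply/mpolyP => m; rewrite [RHS]linear_sum /=.
under eq_bigr do rewrite mcoeff_bicomp.
rewrite mcoeff_pihomog; case: ifP => _; last by rewrite big1.
apply: pihomog_partitionE; have [mG|mG] := boolP (m \in msupp G).
  by rewrite leq_max; apply/orP; right; apply: leq_bigmax_seq mG _.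
by rewrite (memN_msupp_eq0 mG) msize0.
Qed.

End Components.

Lemma on_line_ideal (A : idomainType) n (t : 'I_n -> A) :
  is_ideal (fun f => on_line t f = 0).
Proof.
split=> [|f g f0 g0|f g g0]; first exact: rmorph0.
  by rewrite rmorphD /= f0 g0 addr0.
by rewrite rmorphM /= g0 mulr0.
Qed.

Section ReesIdeal.
Variables (K : closedFieldType) (d : nat) (u : 'I_3 -> ringT K).
Hypothesis hud : forall i, u i \is d.-homog.

(** Substituting [u] for [X] maps forms of degree [j] with coefficients of degree
    [i] to forms of degree [i + d j]. *)
Lemma reesK_bicomp i j (G : ringTX K) : reesK u G -> reesK u (bicomp i j G).
Proof.
move=> Gr; have Gj : (pihomog mdeg j G).@[u] = 0.
  by rewrite -coef_on_line [on_line u G]Gr coef0.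
rewrite reesE (on_line_form u (bihomog_bicomp i j G).1).
suff -> : (bicomp i j G).@[u] = 0 by rewrite scale0r.
have hm (m : 'X_{1..3}) : mdeg m = j -> mmap1 u m \is (d * j).-homog.
  move=> <-; rewrite mdegE big_distrr /=.
  apply: (big_ind2 (fun (x : ringT K) e => x \is e.-homog)).
  - exact: dhomog1.
  - by move=> x e y f; apply: dhomogM.
  - by move=> k _; apply: dhomogMn.
rewrite /bicomp; move: Gj (pihomogP mdeg j G); move: (pihomog _ _ _) => H H0 hH.
have := @pihomog0 2 K mdeg (i + d * j); rewrite -[in LHS]H0.
rewrite /meval /mmap linear_sum /= => e; rewrite -[RHS]e.
rewrite -/(mmap idfun u _) /map_mpoly rmorph_mmap.
apply: eq_big_seq => m mH /=; rewrite mmapC /= pihomogM ?hm ?(dhomog_mf hH) //.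
by congr (_ * _); apply: mmap1_eq => k /=; rewrite mmapX mmap1U.
Qed.

End ReesIdeal.

Section MinimalGenerators.
Variable A : idomainType.
Implicit Types (f g s : A) (S T W : seq A).

(** A bigrading of [A] by a predicate [hom] and component functions [comp],
    whose elements of bidegree (0, 0) form a field. *)
Variables (hom : nat -> nat -> A -> Prop) (comp : nat -> nat -> A -> A).
Hypothesis hom_comp : forall i j f, hom i j (comp i j f).
Hypothesis comp_id : forall i j f, hom i j f -> comp i j f = f.
Hypothesis hom_uniq : forall i j i' j' f, f != 0 ->
  hom i j f -> hom i' j' f -> i = i' /\ j = j'.
Hypothesis compD : forall i j f g, comp i j (f + g) = comp i j f + comp i j g.
Hypothesis compM : forall i j i' j' f g, hom i' j' g ->
  (i' <= i)%N -> (j' <= j)%N -> comp i j (f * g) = comp (i - i') (j - j') f * g.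
Hypothesis compM_eq0 : forall i j i' j' f g, hom i' j' g ->
  ~~ ((i' <= i)%N && (j' <= j)%N) -> comp i j (f * g) = 0.
Hypothesis comp_sum : forall f, exists N, f = \sum_(i < N) \sum_(j < N) comp i j f.
Hypothesis comp00_unit : forall f, comp 0 0 f != 0 -> comp 0 0 f \is a GRing.unit.
Hypothesis A_noetherian : noetherian A.

Variable I : A -> Prop.
Hypothesis I_ideal : is_ideal I.
Hypothesis I_comp : forall i j f, I f -> I (comp i j f).

Let homs S := forall g, g \in S -> exists i j, hom i j g.

Lemma homogeneous_generators :
  exists S, [/\ homs S, forall g, g \in S -> I g & forall f, I f -> ideal_gen S f].
Proof.
have [S0 IS0 gS0] := A_noetherian I_ideal.
suff [S [hS IS gS]] : exists S, [/\ homs S, forall g, g \in S -> I g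
    & forall g, g \in S0 -> ideal_gen S g].
  by exists S; split=> // G /gS0; apply: ideal_gen_trans.
elim: S0 IS0 {gS0} => [|g S0 IH] IS0; first by exists [::]; split=> g; rewrite in_nil.
have [|S [hS IS gS]] := IH; first by move=> x xS; apply: IS0; rewrite in_cons xS orbT.
have [N eg] := comp_sum g.
pose L := [seq comp i j g | i <- iota 0 N, j <- iota 0 N].
have Lg G : G \in L -> exists i j, G = comp i j g.
  by move=> /allpairsP[[i j] [_ _ ->]]; exists i, j.
exists (L ++ S); split=> [x|x|x].
- rewrite mem_cat => /orP[/Lg[i [j ->]]|/hS //].
  by exists i, j; apply: hom_comp.
- rewrite mem_cat => /orP[/Lg[i [j ->]]|/IS //].
  by apply/I_comp/IS0; rewrite in_cons eqxx.
have subL : {subset S <= L ++ S} by move=> y yS; rewrite mem_cat yS orbT.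
rewrite in_cons => /predU1P[->|/gS gx]; last exact: ideal_gen_sub subL gx.
rewrite [X in ideal_gen _ X]eg.
have [gen0 genD _] := ideal_gen_ideal (L ++ S).
apply: (big_ind (ideal_gen (L ++ S)) gen0 genD) => i _.
apply: (big_ind (ideal_gen (L ++ S)) gen0 genD) => j _.
apply: ideal_gen_mem; rewrite mem_cat; apply/orP; left.
by apply/allpairsP; exists (val i, val j); rewrite !mem_iota !ltn_ord.
Qed.

(** The component of bidegree [(i, j)] of a combination of homogeneous
    elements: the generators of lower bidegree contribute to [Z], those of the
    same bidegree with coefficients in the field of bidegree (0, 0). *)
Lemma ideal_gen_comp i j (Z : A -> Prop) W f : is_ideal Z -> homs W ->
  (forall g i' j', g \in W -> hom i' j' g -> (i' <= i)%N -> (j' <= j)%N ->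
     (i', j') <> (i, j) -> Z g) ->
  ideal_gen W f ->
  ideal_gen W (comp i j f) /\
  (Z (comp i j f) \/ exists W1 g W2 b k, [/\ W = W1 ++ g :: W2, hom i j g,
    k \is a GRing.unit, ideal_gen (W1 ++ W2) b & comp i j f = k * g + b]).
Proof.
move=> Zid; have [Z0 ZD ZM] := Zid.
elim: W f => [|g W IH] f hW hZ.
  have comp0 : comp i j 0 = 0 by apply: (addrI (comp i j 0)); rewrite -compD !addr0.
  move=> [c ->]; rewrite big_ord0 comp0; split; last by left.
  by case: (ideal_gen_ideal (Nil A)).
move=> /ideal_gen_cons[c [b [-> gb]]].
have sub : {subset W <= g :: W} by move=> x xW; rewrite in_cons xW orbT.
have [gW alt] := IH b (fun x xW => hW x (sub x xW))
  (fun x i' j' xW => hZ x i' j' (sub x xW)) gb.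
have [_ genD genM] := ideal_gen_ideal (g :: W).
have [i' [j' hg]] : exists i' j', hom i' j' g by apply: hW; rewrite in_cons eqxx.
have [c' ec'] : exists c', comp i j (c * g) = c' * g.
  have [/andP[ii jj]|nij] := boolP ((i' <= i)%N && (j' <= j)%N).
    by eexists; apply: compM hg ii jj.
  by exists 0; rewrite (compM_eq0 _ hg nij) mul0r.
rewrite compD; split.
  rewrite ec'; apply: genD; last exact: ideal_gen_sub gW.
  by apply/genM/ideal_gen_mem; rewrite in_cons eqxx.
case: alt => [Zb|[W1 [g1 [W2 [b1 [k [eW hg1 kn gb1 eb]]]]]]]; last first.
  right; exists (g :: W1), g1, W2, (c' * g + b1), k; split=> //; first by rewrite eW.
    have [_ genD1 genM1] := ideal_gen_ideal (g :: W1 ++ W2); apply: genD1.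
      by apply/genM1/ideal_gen_mem; rewrite in_cons eqxx.
    by apply: ideal_gen_sub gb1 => x xAB; rewrite in_cons xAB orbT.
  by rewrite eb ec' addrCA.
have [/andP[ii jj]|nij] := boolP ((i' <= i)%N && (j' <= j)%N); last first.
  by left; rewrite (compM_eq0 _ hg nij) add0r.
have [[ei ej]|ne] := (i', j') =P (i, j); last first.
  left; apply: ZD => //; rewrite ec'; apply: ZM.
  by apply: (hZ g i' j') => //; rewrite in_cons eqxx.
rewrite (compM _ hg ii jj) ei ej !subnn.
have [->|kn] := eqVneq (comp 0 0 c) 0; first by left; rewrite mul0r add0r.
right; exists [::], g, W, (comp i j b), (comp 0 0 c); split=> //.
  by rewrite -ei -ej.
exact: comp00_unit.
Qed.

(** For the ideal [m] of positive bidegrees, every element of [L] has a nonzero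
    class in [I / m I], witnessed by an ideal [Z] that contains the elements of
    [I] of lower bidegree; and these classes have distinct bidegrees.  A complement of least cardinality then
    gives an irredundant system. *)
Lemma extend_to_minimal_generators (L : seq ((nat * nat) * A)) :
  uniq (unzip1 L) ->
  (forall x, x \in L -> [/\ hom x.1.1 x.1.2 x.2, I x.2 &
     exists Z, [/\ is_ideal Z, ~ Z x.2 & forall g i j, I g -> hom i j g ->
       (i <= x.1.1)%N -> (j <= x.1.2)%N -> (i, j) <> x.1 -> Z g]]) ->
  exists S', homs (unzip2 L ++ S') /\ min_generates I (unzip2 L ++ S').
Proof.
move=> uL hL; set S := unzip2 L.
have hS s : s \in S -> exists i j, [/\ hom i j s, I s &
     exists Z, [/\ is_ideal Z, ~ Z s & forall g i' j', I g -> hom i' j' g ->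
       (i' <= i)%N -> (j' <= j)%N -> (i', j') <> (i, j) -> Z g]].
  by move=> /mapP[[[i j] f] /hL /= h ->]; exists i, j.
have inj x y : x \in L -> y \in L -> x.1 = y.1 -> x = y.
  elim: (L) uL => //= z L' IH /andP[zL' uL']; rewrite !in_cons.
  move=> /predU1P[->|xL'] /predU1P[->|yL'] // e; last exact: IH.
    by case/negP: zL'; rewrite e; apply: map_f.
  by case/negP: zL'; rewrite -e; apply: map_f.
have deg x i j : x \in L -> hom i j x.2 -> x.1 = (i, j).
  move=> xL h; have [hx _ [Z [[Z0 _ _] nZ _]]] := hL x xL.
  have xn : x.2 != 0 by apply/eqP => z; rewrite z in nZ.
  by have [e1 e2] := hom_uniq xn hx h; case: x.1 e1 e2 => ? ? /= -> ->.
have dist s s' i j : s \in S -> s' \in S -> hom i j s -> hom i j s' -> s = s'.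
  move=> /mapP[x xL ->] /mapP[y yL ->] hx hy; congr snd; apply: inj => //.
  by rewrite (deg x i j) // (deg y i j).
have uS : uniq S.
  rewrite map_inj_in_uniq ?(map_uniq uL) // => x y xL yL e; apply: inj => //.
  have [hx _ _] := hL x xL; have [hy _ _] := hL y yL.
  by rewrite (deg x y.1.1 y.1.2) ?e // -surjective_pairing.
pose R S' := homs (S ++ S') /\ generates I (S ++ S').
have [S' [hS' gS'] minS'] : exists2 S', R S' &
    forall S'', R S'' -> (size S' <= size S'')%N.
  have [B [hB IB gB]] := homogeneous_generators.
  have: R B.
    split=> [g|G]; first rewrite mem_cat => /orP[/hS[i [j []]]|/hB //].
      by exists i, j.
    split=> [/gB|]; first by apply: ideal_gen_sub => g gB'; rewrite mem_cat gB' orbT.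
    apply: ideal_gen_min => // g; rewrite mem_cat => /orP[/hS[i [j []]]|/IB //].
    by [].
  have [n] := ubnP (size B); elim: n B {hB IB gB} => // n IH B sB RB.
  have [[B' [RB' lt]]|nex] := Classical_Prop.classic
      (exists B', R B' /\ (size B' < size B)%N).
    by apply: IH RB'; apply: leq_trans lt _.
  exists B => // B' RB'; rewrite leqNgt; apply/negP => lt.
  by apply: nex; exists B'.
exists S'; split=> //; split=> // T /subseqP[m sm eT] gT.
move: eT; rewrite -(cat_take_drop (size S) m) mask_cat ?size_take; last first.
  by rewrite sm size_cat; case: ltnP => // le; apply/eqP; rewrite eqn_leq le leq_addr.
set W1 := mask _ S; set W2 := mask _ S' => eT.
have W1S : {subset W1 <= S} by move=> x; apply: mem_mask.
have W2S : {subset W2 <= S'} by move=> x; apply: mem_mask.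
have inI g : g \in S ++ S' -> I g by move=> /ideal_gen_mem /gS'.
have eW2 : W2 = S'.
  have sub2 : subseq W2 S' by apply: mask_subseq.
  apply/eqP; rewrite -(size_subseq_leqif sub2) eqn_leq size_subseq //=.
  apply: minS'; split=> [g|G].
    by rewrite mem_cat => gSW; apply: hS'; rewrite mem_cat; case/orP: gSW => [->//|/W2S->]; rewrite orbT.
  split=> [/gT|].
    by rewrite eT; apply: ideal_gen_sub => g; rewrite !mem_cat => /orP[/W1S->//|->]; rewrite orbT.
  apply: ideal_gen_min => // g; rewrite mem_cat => gSW; apply: inI.
  by rewrite mem_cat; case/orP: gSW => [->//|/W2S->]; rewrite orbT.
suff SW1 : {subset S <= W1}.
  rewrite eT eW2; congr (_ ++ _); apply/eqP.
  have sub1 : subseq W1 S by apply: mask_subseq.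
  by rewrite -(size_subseq_leqif sub1) eqn_leq size_subseq // uniq_leq_size.
move=> s sS; apply: contraT => sW1.
have [i [j [hs Is [Z [Zid nZs hZ]]]]] := hS s sS.
have subW : {subset T <= S ++ S'}.
  by move=> x; rewrite eT eW2 !mem_cat => /orP[/W1S->//|->]; rewrite orbT.
have [|||_] := @ideal_gen_comp i j Z T s Zid.
- by move=> g /subW/hS'.
- by move=> g i' j' /subW/inI; apply: hZ.
- exact/gT.
rewrite (comp_id hs) => -[//|[V1 [g [V2 [b [k [eW hg kn gb es]]]]]]].
have gW : g \in W1 ++ S' by rewrite -eW2 -eT eW mem_cat in_cons eqxx orbT.
have gW1 : g \notin W1.
  by apply: contra sW1 => gW1; rewrite (dist s g i j) // W1S.
have gS1 : g \in S' by move: gW; rewrite mem_cat (negPf gW1).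
have VS : {subset V1 ++ V2 <= S ++ rem g S'}.
  have pV : perm_eq (V1 ++ V2) (W1 ++ rem g S').
    rewrite -(perm_cons g).
    apply: (@perm_trans _ (V1 ++ g :: V2)).
      by rewrite -cat1s -[g :: V2]cat1s perm_catCA.
    rewrite -eW eT eW2 -[g :: W1 ++ _]cat1s perm_sym perm_catCA /= perm_cat2l.
    by rewrite perm_sym perm_to_rem.
  by move=> x; rewrite (perm_mem pV) !mem_cat => /orP[/W1S->//|->]; rewrite orbT.
have [_ genD genM] := ideal_gen_ideal (S ++ rem g S').
have gg : ideal_gen (S ++ rem g S') g.
  have eg : g = k^-1 * (s - b) by rewrite es addrK mulKr.
  rewrite [X in ideal_gen _ X]eg.
  apply: genM; apply: (ideal_sub (ideal_gen_ideal _)); last exact: ideal_gen_sub gb.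
  by apply: ideal_gen_mem; rewrite mem_cat sS.
have subS x : x \in S ++ rem g S' -> x \in S ++ S'.
  by rewrite !mem_cat => /orP[->//|/mem_rem ->]; rewrite orbT.
have /minS' : R (rem g S').
  split=> [x /subS/hS' //|G]; split=> [/gS'|].
    apply: ideal_gen_trans => x xSS; have [->//|xg] := eqVneq x g.
    apply: ideal_gen_mem; move: xSS; rewrite !mem_cat => /orP[->//|xS'].
    by rewrite (rem_mem xg xS') orbT.
  by apply: ideal_gen_min => // x /subS/inI.
rewrite size_rem // => le; have: (0 < size S')%N by case: (S') gS1.
by move: le; case: (size S') => // n; rewrite ltnn.
Qed.

End MinimalGenerators.

Section ReesGenerators.
Variables (K : closedFieldType) (d : nat) (u : 'I_3 -> ringT K).
Hypothesis hud : forall i, u i \is d.-homog.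

Lemma bicomp00_unit (f : (ringTX K : idomainType)) :
  bicomp 0 0 f != 0 -> bicomp 0 0 f \is a GRing.unit.
Proof.
have [/form0P e h0] := bihomog_bicomp 0 0 f.
rewrite (form0P (h0 0%MM)) in e; rewrite e => nz.
apply/rmorph_unit/rmorph_unit; rewrite unitfE.
by apply: contraNneq nz => ->; rewrite !mpolyC0.
Qed.

Lemma noetherian_ringTX : noetherian (ringTX K : idomainType).
Proof. exact/noetherian_mpoly/noetherian_mpoly/noetherian_field. Qed.

Lemma rees_part_of_min_generators (L : seq ((nat * nat) * ringTX K)) :
  uniq (unzip1 L) ->
  (forall x, x \in L -> [/\ bihomog x.1.1 x.1.2 x.2, reesK u x.2 &
     exists Z : ringTX K -> Prop, [/\ is_ideal Z, ~ Z x.2 &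
       forall g i j, reesK u g -> bihomog i j g ->
         (i <= x.1.1)%N -> (j <= x.1.2)%N -> (i, j) <> x.1 -> Z g]]) ->
  part_of_min_generators u (unzip2 L).
Proof.
(* The two statements are convertible: they differ in the way in which the ring
   structures of [K[T][X]] are derived from that of [K]. *)
exact_no_check (@extend_to_minimal_generators (ringTX K : idomainType)
  (@bihomog K) (@bicomp K)
  ltac:(exact_no_check (@bihomog_bicomp K)) ltac:(exact_no_check (@bicomp_id K))
  ltac:(exact_no_check (@bihomog_uniq K)) ltac:(exact_no_check (@bicompD K))
  ltac:(exact_no_check (@bicompM K)) ltac:(exact_no_check (@bicompM_eq0 K))
  ltac:(exact_no_check (@bicomp_sum K)) ltac:(exact_no_check bicomp00_unit)
  noetherian_ringTX (reesK u) ltac:(exact_no_check (on_line_ideal u))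
  ltac:(exact_no_check (@reesK_bicomp K d u hud)) L).
Qed.

End ReesGenerators.

(** * The sequence of moving curves *)

Lemma dhomog_associate n (R : idomainType) j (f g : {mpoly R[n]}) :
  f \is j.-homog -> g \is j.-homog -> f != 0 -> multiple_of f g ->
  exists2 c, c != 0 & f = c *: g.
Proof.
move=> hf hg fn [x e]; set c := (pihomog mdeg 0 x)@_0.
have ef : f = c *: g.
  rewrite -mul_mpolyC -form0P; last exact: pihomogP.
  by rewrite -(pihomogM 0 x hg) -e pihomog_dE.
by exists c => //; apply: contraNneq fn => z; rewrite ef z scale0r.
Qed.

Section ConstT.
Variable K : closedFieldType.

Lemma dhomog_constT j (g : ringX K) : g \is j.-homog -> constT g \is j.-homog.
Proof.
move=> hg; apply/dhomogP => m; rewrite mcoeff_msupp /constT mcoeff_map_mpoly /=.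
rewrite mpolyC_eq0 -mcoeff_msupp; exact: (dhomog_mf hg).
Qed.

Lemma bihomog_constT j (g : ringX K) : g \is j.-homog -> bihomog 0 j (constT g).
Proof.
move=> hg; split=> [|m]; first exact: dhomog_constT.
rewrite /constT mcoeff_map_mpoly /= -[_%:MP]mulr1 mul_mpolyC.
by rewrite rpredZ // dhomog1.
Qed.

Lemma constT_eq0 (g : ringX K) : constT g = 0 -> g = 0.
Proof.
move=> z; apply/mpolyP => m; have := congr1 (mcoeff m) z.
rewrite /constT mcoeff_map_mpoly !mcoeff0 /= => /eqP.
by rewrite mpolyC_eq0 => /eqP.
Qed.

Lemma bihomog0_constT j (G : ringTX K) : bihomog 0 j G ->
  exists2 g, g \is j.-homog & G = constT g.
Proof.
move=> [hG h0]; exists (map_mpoly (mcoeff 0%MM) G).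
  apply/dhomogP => m; rewrite mcoeff_msupp mcoeff_map_mpoly => nz.
  apply: (dhomog_mf hG); rewrite mcoeff_msupp.
  by apply: contraNneq nz => -> /=; rewrite mcoeff0.
apply/mpolyP => m; rewrite /constT !mcoeff_map_mpoly /=.
exact: form0P.
Qed.

End ConstT.

Lemma Fdeg_add d mu k r j : d%:Z = k%:Z * mu%:Z + r ->
  (-1 <= r) && (r < mu%:Z - 1) -> (1 <= j <= k - 1)%N ->
  (Fdeg mu k r j + mu * j)%N = d.
Proof.
move=> hd /andP[r1 r2] /andP[j1 jk]; rewrite /Fdeg.
have : (mu%:Z <= (k%:Z - j%:Z) * mu%:Z)%R by nia.
by lia.
Qed.

Section Conclusion.
Variables (K : closedFieldType) (d mu k : nat) (r : int) (u : 'I_3 -> ringT K).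
Variables (E : ringX K) (P Q : ringTX K) (F : nat -> ringTX K).
Hypotheses (hu : parametrization u d) (hE : curve_equation u d E).
Hypotheses (hPQ : mu_basis u d mu P Q) (hmu : (mu < d - mu)%N).
Hypothesis hsing : very_singular mu E (point001 K).
Hypotheses (hd : d%:Z = k%:Z * mu%:Z + r) (hr : (-1 <= r) && (r < mu%:Z - 1)).
Hypothesis hF : F_sequence mu k r P Q F.

Let mu_gt0 : (0 < mu)%N. Proof. by case/andP: hr; lia. Qed.
Let d_gt1 : (1 < d)%N. Proof. by move: hmu mu_gt0; lia. Qed.
Let k_gt1 : (1 < k)%N. Proof. by case/andP: hr => r1 r2; move: hmu mu_gt0; nia. Qed.

Let hP2 : P@_U_(ord_max) = 0.
Proof. exact: very_singular_mu_basis hu hE hPQ mu_gt0 d_gt1 hsing. Qed.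

Let hP : bihomog mu 1 P. Proof. by case: hPQ => _ []. Qed.
Let hQ : bihomog (d - mu) 1 Q. Proof. by case: hPQ => _ _ []. Qed.
Let hPr : reesK u P. Proof. by case: hPQ => _ []. Qed.
Let hQr : reesK u Q. Proof. by case: hPQ => _ _ []. Qed.

Let eP : P = moving_line (p_0 P) (p_1 P).
Proof. exact: mu_basis_moving_line hPQ hP2. Qed.

Let P_neq0 : P != 0.
Proof.
apply/eqP => z; have := mu_basis_primitive hPQ (g := 0) (P' := 0).
by rewrite scale0r unitr0 => /(_ z).
Qed.

Lemma low_multiple i j G : bihomog i j G -> reesK u G -> (i + mu * j < d)%N ->
  multiple_of G P.
Proof. exact: low_degree_multiple hu hE hPQ mu_gt0 d_gt1 hP2 i j G. Qed.

Lemma F_properties j : (1 <= j <= k - 1)%N ->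
  [/\ bihomog (Fdeg mu k r j) j (F j), reesK u (F j) &
      on_moving_line (p_0 P) (p_1 P) (F j) = on_moving_line (p_0 P) (p_1 P) Q].
Proof.
have [F1 FS] := hF; elim: j => [/andP[j0 _]|j IH /andP[_ jk]].
  by exfalso; rewrite ltn0 in j0.
have [->|j0] := posnP j.
  rewrite F1; split=> //; have := @Fdeg_add d mu k r 1 hd hr.
  by rewrite /= subn_gt0 k_gt1 muln1 => /(_ erefl) e; rewrite -(addnK mu (Fdeg _ _ _ _)) e.
have jj : (1 <= j <= k - 1)%N by rewrite j0 (leq_trans _ jk).
have [hj jr je] := IH jj.
have DTj : DT mu P (Fdeg mu k r j) j (F j) (F j.+1).
  by apply: (FS j.+1); rewrite ltnS j0.
split.
- have := bihomog_DT DTj; congr (bihomog _ _ _).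
  have := Fdeg_add hd hr jj.
  have := @Fdeg_add d mu k r j.+1 hd hr; rewrite jk => /(_ erefl) <-.
  by rewrite mulnS addnA => /addIn ->; rewrite addnK.
- exact: (reesK_DT hE hPQ mu_gt0 d_gt1 hP2 DTj jr).
- by rewrite (on_mu_line_DT DTj).
Qed.

Lemma on_mu_line_Q_neq0 : on_moving_line (p_0 P) (p_1 P) Q != 0.
Proof.
apply/eqP => z.
have := on_mu_line_eq0 hE hPQ mu_gt0 d_gt1 hP2 hQ.1 z.
by move=> /(multiple_of_form_linear hPQ hQ.1)[c] /(mu_basis_independent hPQ).
Qed.

Lemma F_not_multiple j : (1 <= j <= k - 1)%N -> ~ multiple_of (F j) P.
Proof.
move=> /F_properties[_ _ e] /(on_mu_line_multiple hPQ hP2) z.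
by have := on_mu_line_Q_neq0; rewrite -e z eqxx.
Qed.

Lemma resT_F j : (1 <= j <= k - 1)%N ->
  exists c : K, c != 0 /\ resT mu (Fdeg mu k r j) P (F j) = c *: E.
Proof.
move=> jk; have [[hj hjT] jr je] := F_properties jk.
set n := Fdeg mu k r j; set N := resT _ _ _ _.
have Nn : N != 0.
  rewrite /N eP; apply: (@resT_moving_line_neq0 _ mu n j) => //.
  - by rewrite /p_0 rpredN; apply: hP.2.
  - exact: hP.2.
  - exact: p1_neq0 hE hPQ d_gt1 hP2.
  - exact: p_no_common_zero hPQ mu_gt0 hP2.
  - by rewrite je on_mu_line_Q_neq0.
have hN : N \is d.-homog.
  rewrite -(Fdeg_add hd hr jk) -[Fdeg _ _ _ _]muln1.
  exact: dhomog_resT hP.1 hj.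
have nm0 : (0 < n + mu)%N by rewrite addn_gt0 mu_gt0 orbT.
have Nr : reesK u (constT N).
  by rewrite reesE; apply: (resT_eliminates hP.2 hjT nm0 (on_line_monT_neq0 u) hPr jr).
have [_ hEd _ hEK] := hE.
have [c cn ec] := dhomog_associate hN hEd Nn ((hEK N).1 Nr).
by exists c.
Qed.

(** The elements of the ideal whose bidegree is lower than that of [E] or [P]
    vanish; those whose bidegree [(a, b)] is lower than that of an [F_j] satisfy
    [a + mu b < d], so they are multiples of [P]. *)
Lemma part_of_min_generators_of (L : seq ((nat * nat) * ringTX K)) :
  uniq (unzip1 L) ->
  (forall x, x \in L -> [\/ x = ((0%N, d), constT E), x = ((mu, 1%N), P) |
     exists2 j, (1 <= j <= k - 1)%N & x = ((Fdeg mu k r j, j), F j)]) ->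
  part_of_min_generators u (unzip2 L).
Proof.
move=> uL hL; have [_ hud _] := hu.
apply: (rees_part_of_min_generators hud uL).
have zero_ideal : is_ideal (fun x : ringTX K => x = 0).
  by split=> [|x y -> ->|x y ->] //; rewrite ?addr0 ?mulr0.
move=> x /hL[->|->|[j jk ->]] /=.
- have [[En _ _] hEd _ hEK] := hE; split.
  + exact: bihomog_constT.
  + by apply/hEK/multiple_of_refl.
  exists (fun x => x = 0); split=> //.
    by move=> /constT_eq0 /eqP; rewrite (negPf En).
  move=> g i j gr hg; rewrite leqn0 => /eqP i0 jd ne; subst i.
  have [g' hg' eg] := bihomog0_constT hg.
  have jd' : (j < d)%N.
    by rewrite ltn_neqAle jd andbT; apply/eqP => e; apply: ne; rewrite e.
  by move: gr; rewrite eg => /(rees_constT_eq0 hE hg' jd') ->; apply: rmorph0.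
- split=> //; exists (fun x => x = 0); split=> //; first exact/eqP.
  move=> g i j gr hg il jl ne.
  have gP : multiple_of g P by apply: low_multiple hg gr _; move: hmu; nia.
  have [j0|j1] : (j < 1)%N \/ j = 1%N by lia.
    exact: form_dvd_eq0 hP.1 hg.1 P_neq0 j0 gP.
  have imu : (i < mu)%N.
    by rewrite ltn_neqAle il andbT; apply/eqP => e; apply: ne; rewrite e j1.
  have hg1 : g \is 1.-homog by have [+ _] := hg; rewrite j1.
  have [c ec] := multiple_of_form_linear hPQ hg1 gP.
  have lP : mleadc P != 0 by rewrite mleadc_eq0.
  have: g@_(mlead P) = 0.
    apply: form_dvd_eq0 (hP.2 _) (hg.2 _) lP imu _.
    by rewrite ec mcoeffZ; exists c.
  rewrite ec mcoeffZ => /eqP; rewrite mulf_eq0 (negPf lP) orbF => /eqP ->.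
  exact: scale0r.
- have [hj jr _] := F_properties jk; split=> //.
  exists (fun x => multiple_of x P); split; last 1 first.
  + move=> g i' j' gr hg il jl ne; apply: low_multiple hg gr _.
    rewrite -(Fdeg_add hd hr jk) ltn_neqAle leq_add ?leq_mul //= andbT.
    by apply/eqP => e; apply: ne; move: (Fdeg mu k r j) il e => n il e; congr (_, _); nia.
  + exact: multiple_of_ideal.
  + exact: F_not_multiple.
Qed.

End Conclusion.

(** * The theorem *)

Theorem theorem2p10 (K : closedFieldType) (d mu k : nat) (r : int)
    (u : 'I_3 -> ringT K) (E : ringX K) (P Q : ringTX K)
    (F : nat -> ringTX K)
    (hu : parametrization u d) (hproper : proper_param u)
    (hE : curve_equation u d E)
    (hPQ : mu_basis u d mu P Q)
    (hmu : (mu < d - mu)%N)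
    (hsing : very_singular mu E (point001 K))
    (hd : d%:Z = k%:Z * mu%:Z + r) (hr : (-1 <= r) && (r < mu%:Z - 1))
    (hF : F_sequence mu k r P Q F) :
  [/\ (forall j, (1 <= j <= k - 1)%N ->
         [/\ reesK u (F j), ~ multiple_of (F j) P & F j <> 0]),
      (forall j, (1 <= j <= k - 1)%N ->
         exists c : K, c != 0 /\ resT mu (Fdeg mu k r j) P (F j) = c *: E),
      (forall i j (G : ringTX K), bihomog i j G -> reesK u G ->
         (i + mu * j < d)%N -> multiple_of G P)
    & (* When mu = 1, F_{mu+r,k-1} = F_{0,d} is a nonzero constant times E_d,
         so that the system listed for mu > 1 would contain E_d twice. *)
      ((1 < mu)%N ->
         part_of_min_generators u
           [:: constT E, P & [seq F (k - j)%N | j <- iota 1 (k - 1)]]) /\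
      (mu = 1%N ->
         part_of_min_generators u
           (P :: [seq F (k - j)%N | j <- iota 1 (k - 1)]))].
Proof.
have FL j : j \in iota 1 (k - 1) -> (1 <= k - j <= k - 1)%N.
  by rewrite mem_iota; lia.
pose LF := [seq ((Fdeg mu k r (k - j), (k - j)%N), F (k - j)%N)
            | j <- iota 1 (k - 1)].
have LF2 : unzip2 LF = [seq F (k - j)%N | j <- iota 1 (k - 1)].
  by rewrite /unzip2 /LF -map_comp.
have LFP x : x \in LF ->
    exists2 j, (1 <= j <= k - 1)%N & x = ((Fdeg mu k r j, j), F j).
  by move=> /mapP[j /FL jk ->]; exists (k - j)%N.
have LFdeg x : x \in unzip1 LF -> (1 <= x.2)%N /\ (x.1 + mu * x.2 = d)%N.
  by move=> /mapP[_ /LFP[j jk ->] ->] /=; rewrite (Fdeg_add hd hr jk); case/andP: jk.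
have uLF : uniq (unzip1 LF).
  rewrite /unzip1 /LF -map_comp map_inj_in_uniq ?iota_uniq // => i j.
  by move=> /FL ik /FL jk [_]; move: ik jk; lia.
have PLF : (mu, 1%N) \notin unzip1 LF.
  by apply/negP => /LFdeg[_] /= e; move: hmu; rewrite -e; lia.
have parts := part_of_min_generators_of hu hE hPQ hmu hsing hd hr hF.
split.
- move=> j jk; have [_ jr _] := F_properties hu hE hPQ hmu hsing hd hr hF jk.
  have nm := F_not_multiple hu hE hPQ hmu hsing hd hr hF jk; split=> // z.
  by apply: nm; rewrite z; apply: multiple_of0.
- exact: resT_F hu hE hPQ hmu hsing hd hr hF.
- exact: low_multiple hu hE hPQ hmu hsing hd hr.
split=> mu1.
- pose L := [:: ((0%N, d), constT E), ((mu, 1%N), P) & LF].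
  rewrite -LF2 -[_ :: _]/(unzip2 L); apply: parts.
    rewrite /= in_cons negb_or PLF uLF !andbT; apply/andP; split.
      by apply/eqP => -[e _]; move: mu1; rewrite -e.
    apply/negP => /LFdeg[_] /=; rewrite add0n.
    by case/andP: hr => r1 r2; have := hd; move: mu1 hmu; nia.
  by move=> x; rewrite !in_cons => /or3P[/eqP ->|/eqP ->|/LFP];
    [constructor 1 | constructor 2 | constructor 3].
pose L := ((mu, 1%N), P) :: LF.
rewrite -LF2 -[_ :: _]/(unzip2 L); apply: parts; first by rewrite /= PLF uLF.
by move=> x; rewrite in_cons => /orP[/eqP ->|/LFP];
  [constructor 2 | constructor 3].
Qed.
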